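(* Suppose $R>0$ and a non-decreasing function $\rho:(R,\infty)\to\mathbb{R}_{\geq 0}$ of class $C^1$ are such that $$\int_{R}^\infty\frac{\rho(s)}{s^2}\,ds=\infty.$$ If $\mu$ is a positive Borel measure on $\mathbb{R}^n$ such that $$\int_{\Vert x\Vert>R} \exp\left(\int_{R}^{\Vert x\Vert}\frac{\rho(s)}{s}\,ds\right)d\mu(x)<\infty,$$ then $\mu$ is determinate. Furthermore, the polynomials and $\operatorname{Span}_{\mathbb{C}}\{e_{i\lambda}\mid\lambda\in S\}$ are then dense in $L_p(\mathbb{R}^n,\mu)$ for all $1\leq p<\infty$ and for every subset $S$ of $\mathbb{R}^n$ which is somewhere dense.
   Context: $(\cdot,\cdot)$ is the standard inner product on $\mathbb{R}^n$ with norm $\Vert\cdot\Vert$. For $\lambda\in\mathbb{R}^n$, $e_{i\lambda}:\mathbb{R}^n\to\mathbb{C}$ is $e_{i\lambda}(x)=\exp(i(\lambda,x))$. A subset $S\subset\mathbb{R}^n$ is somewhere dense if its closure has non-empty interior. $\mathcal{M}^*$ is the set of all positive Borel measures $\mu$ on $\mathbb{R}^n$ such that $\int_{\mathbb{R}^n}\Vert x\Vert^d\,d\mu(x)<\infty$ for all $d\ge 0$. A measure $\mu$ is determinate if $\mu\in\mathcal{M}^*$ and $\mu$ is uniquely determined in $\mathcal{M}^*$ by the integrals $\int_{\mathbb{R}^n}P\,d\mu$ of all polynomials $P$ on $\mathbb{R}^n$ (i.e. any $\nu\in\mathcal{M}^*$ with the same integrals of all polynomials equals $\mu$). $L_p$-spaces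 consist of complex-valued functions and polynomials have complex coefficients.
   Formalization: The measure μ is additionally assumed finite on compact sets; without this the claim fails, e.g. for μ = ∞·δ₀, which satisfies the weight condition on ‖x‖ > R but is not in M*. *)

(* Defs.v *)
From HB Require Import structures.
From mathcomp Require Import all_boot all_order all_algebra.
From mathcomp Require Import all_classical all_reals all_analysis.
From mathcomp Require Import complex.
(* Not imported: the notations of mpoly clash with those of MathComp-Analysis. *)
From mathcomp Require mpoly.

Set Implicit Arguments.
Unset Strict Implicit.
Unset Printing Implicit Defensive.

Import Order.TTheory GRing.Theory Num.Theory.
Import numFieldNormedType.Exports.

Local Open Scope classical_set_scope.
Local Open Scope ring_scope.

(* R^n with its Borel sigma-algebra. The library norm `|x| on 'rV[R]_n is the
   sup norm; it is only used through its topology, which is the usual one. *)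
Definition borelRn (R : realType) (n : nat) :=
  g_sigma_algebraType (@open 'rV[R]_n).

Section Euclidean.
Context {R : realType} {n : nat}.
Implicit Types x y l : 'rV[R]_n.

Definition inner x y : R := \sum_(i < n) x 0 i * y 0 i.

Definition enorm x : R := Num.sqrt (inner x x).

Definition expi l x : R[i] := (cos (inner l x) +i* sin (inner l x))%C.

Definition polyfun (P : mpoly.mpoly n R[i]) x : R[i] :=
  mpoly.meval (fun i => (x 0 i)%:C%C) P.

Definition somewhere_dense (S : set 'rV[R]_n) := (closure S)° !=set0.

End Euclidean.

(* Meant for open D: the derivatives involve values of f near s. *)
Definition C1_on {R : realType} (D : set R) (f : R -> R) :=
  forall s, D s -> derivable f s 1 /\ {for s, continuous (derive1 f)}.

Definition Cspan {T : Type} {R : realType} (F : set (T -> R[i])) : set (T -> R[i]) :=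
  [set g | exists (k : nat) (c : 'I_k -> R[i]) (f : 'I_k -> T -> R[i]),
    (forall j, F (f j)) /\ g = fun x => \sum_(j < k) c j * f j x].

Section ComplexFunctions.
Context {d : measure_display} {T : measurableType d} {R : realType}.
Implicit Types (mu : {measure set T -> \bar R}) (f g : T -> R[i]).

Definition cmeasurable f :=
  measurable_fun setT (fun x => complex.Re (f x)) /\
  measurable_fun setT (fun x => complex.Im (f x)).

Definition cintegral mu f : R[i] :=
  (Rintegral mu setT (fun x => complex.Re (f x)) +i*
   Rintegral mu setT (fun x => complex.Im (f x)))%C.

Definition cLnorm mu (p : R) f : \bar R :=
  Lnorm mu p%:E (fun x => (ComplexField.Normc.normc (f x))%:E).

Definition inLp mu (p : R) f := cmeasurable f /\ (cLnorm mu p f < +oo)%E.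

(* F is contained in L_p(mu) and meets every L_p-ball; working with functions
   rather than classes modulo null sets changes nothing, as the seminorm only
   depends on the class. *)
Definition dense_in_Lp mu (p : R) (F : set (T -> R[i])) :=
  (forall g, F g -> inLp mu p g) /\
  (forall f, inLp mu p f -> forall e : R, 0 < e ->
    exists2 g, F g & (cLnorm mu p (fun x => (f x - g x)%R) < e%:E)%E).

End ComplexFunctions.

Section Determinacy.
Context {R : realType} {n : nat}.
Implicit Types mu nu : {measure set (borelRn R n) -> \bar R}.

Definition finite_moments mu := forall a : R, 0 <= a ->
  (\int[mu]_x (enorm x `^ a)%:E < +oo)%E.

Definition determinate mu :=
  finite_moments mu /\
  forall nu, finite_moments nu ->
    (forall P, cintegral nu (polyfun P) = cintegral mu (polyfun P)) ->
    forall A : set (borelRn R n), measurable A -> nu A = mu A.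

End Determinacy.

(* Main.v *)
Require Import Defs.
From HB Require Import structures.
From mathcomp Require Import all_boot all_order all_algebra.
From mathcomp Require Import all_classical all_reals all_analysis.
From mathcomp Require Import measurable_realfun complex ring lra.
From mathcomp Require mpoly.

(* Carleman's condition. Let [Phi t] be the integral of [rho s / s] over [r, t]
   and [m k] the supremum of the [t] with [rho t <= p (k + 1)]. Then
   [t ^ (p j) <= (m 0 ... m (j - 1)) ^ p * exp (Phi t)], so the [L_p]-norm of
   [|x| ^ j] is at most [M j = C * m 0 * ... * m (j - 1)], while divergence of
   the integral of [rho s / s ^ 2] means that [sum 1 / m k] diverges.

   Quasi-analyticity without duality. For a linear space [F] of functions in
   [L_p], let [f j t] be [<v, x> ^ j * exp (i <l + t v, x>)]. By Taylor's formula
   the [L_p]-distances from the [f j t] to [F] obey the inequalities satisfied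
   by the derivatives of a function of class [M], so Bang's proof of the
   Denjoy-Carleman theorem applies to them: if all [f j 0] lie in the closure of
   [F], then so do the [f j t]. For [F] the polynomials take [l = 0]. For [F] the
   span of the exponentials with frequencies in [S] take [l] interior to the
   closure of [S], where difference quotients put [f j 0] in the closure of [F].
   In both cases the closure of [F] contains all exponentials.

   The exponentials are total in [L_p] for any finite Borel measure: sets whose
   indicator is a bounded pointwise limit of real trigonometric polynomials form
   a pi-system generating the Borel sets.

   Determinacy. If [nu] has the moments of [mu], then [mu + nu] satisfies the
   Carleman condition as well, and an indicator approximated by polynomials in
   [L_1 (mu + nu)] has the same integral for [mu] and [nu]. *)

Import Order.TTheory GRing.Theory Num.Theory.
Import numFieldNormedType.Exports.
(* The notations of mpoly clash with those of MathComp-Analysis. *)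
Import (canonicals) mpoly.
Local Open Scope classical_set_scope.
Local Open Scope ring_scope.

Set Implicit Arguments.
Unset Strict Implicit.

Local Notation normc := ComplexField.Normc.normc.

(** * Taylor expansion of the exponential *)

Lemma normc_ge0 (R : rcfType) (z : R[i]) : 0 <= normc z.
Proof. by case: z => a b /=; rewrite sqrtr_ge0. Qed.

Lemma normcR (R : rcfType) (a : R) : normc a%:C%C = `|a|.
Proof. by rewrite /= expr0n addr0 sqrtr_sqr. Qed.

Lemma normci (R : rcfType) : normc ('i%C : R[i]) = 1.
Proof. by rewrite /= expr0n expr1n add0r sqrtr1. Qed.

Lemma normcX (R : rcfType) (z : R[i]) k : normc (z ^+ k) = normc z ^+ k.
Proof.
elim: k => [|k IH]; first by rewrite !expr0 ComplexField.Normc.normc1.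
by rewrite !exprS ComplexField.Normc.normcM IH.
Qed.

Lemma normcD (R : rcfType) (z w : R[i]) : normc (z + w) <= normc z + normc w.
Proof. exact: (@le_normcD R z w). Qed.

Lemma normcN (R : rcfType) (z : R[i]) : normc (- z) = normc z.
Proof. exact: (@normcN R z). Qed.

Lemma normc_le_ReIm (R : rcfType) (z : R[i]) :
  normc z <= `|complex.Re z| + `|complex.Im z|.
Proof.
case: z => a b; rewrite [complex.Re _]/= [complex.Im _]/=.
have -> : (a +i* b)%C = a%:C%C + 'i%C * b%:C%C.
  by apply/eqP; rewrite eq_complex /=; apply/andP; split; apply/eqP; ring.
apply: (le_trans (normcD _ _)).
by rewrite ComplexField.Normc.normcM normci mul1r !normcR.
Qed.

Lemma Re_le_normc (R : rcfType) (z : R[i]) : `|complex.Re z| <= normc z.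
Proof.
case: z => a b /=; rewrite -sqrtr_sqr ler_wsqrtr// lerDl sqr_ge0//.
Qed.

Lemma Im_le_normc (R : rcfType) (z : R[i]) : `|complex.Im z| <= normc z.
Proof.
case: z => a b /=; rewrite -sqrtr_sqr ler_wsqrtr// lerDr sqr_ge0//.
Qed.

Section taylor.
Context {R : realType}.
Implicit Types (t : R).

Definition cis t : R[i] := (cos t +i* sin t)%C.

Lemma cisD t u : cis (t + u) = cis t * cis u.
Proof.
by apply/eqP; rewrite eq_complex /= cosD sinD; apply/andP; split; apply/eqP; ring.
Qed.

Lemma cis0 : cis 0 = 1.
Proof. by rewrite /cis cos0 sin0. Qed.

Lemma normc_cis t : normc (cis t) = 1.
Proof. by rewrite /= cos2Dsin2 sqrtr1. Qed.

(** Mean value theorem on the segment between [0] and [x]: the slope is taken at a point of smaller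
    modulus. The factor [1 / (n + 1)] that integration would give is dropped, since the later
    arguments absorb it. *)
Lemma primitive_bound (g dg : R -> R) n :
  (forall x : R, is_derive x 1 g (dg x)) -> g 0 = 0 ->
  (forall x, `|dg x| <= `|x| ^+ n) -> forall x, `|g x| <= `|x| ^+ n.+1.
Proof.
move=> gd g0 dgb x.
have gc : continuous g.
  by move=> y; apply/differentiable_continuous/derivable1_diffP; have [] := gd y.
have gcw a b : {within `[a, b], continuous g} by exact: continuous_subspaceT.
have [x0|x0] := leP 0 x.
  have [c /[!in_itv]/= /andP[c0 cx]] := MVT_segment x0 (fun y _ => gd y) (gcw _ _).
  rewrite g0 !subr0 => ->; rewrite normrM exprSr ler_wpM2r//.
  apply: le_trans (dgb c) _; rewrite lerXn2r ?nnegrE//.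
  by rewrite !ger0_norm.
have [c /[!in_itv]/= /andP[c0 cx]] := MVT_segment (ltW x0) (fun y _ => gd y) (gcw _ _).
rewrite g0 !sub0r => /eqP; rewrite eqr_oppLR => /eqP ->.
rewrite mulrN opprK normrM exprSr ler_wpM2r//.
apply: le_trans (dgb c) _; rewrite lerXn2r ?nnegrE//.
by rewrite !ler0_norm ?lerN2// ltW.
Qed.

(** Taking real and imaginary parts of ['i ^+ k] encodes the signs and vanishing coefficients of the
    Taylor polynomials of degree less than [n] without parity cases. *)
Definition cosT n : {poly R} := \poly_(k < n) (complex.Re ('i ^+ k)%C / k`!%:R).
Definition sinT n : {poly R} := \poly_(k < n) (complex.Im ('i ^+ k)%C / k`!%:R).

Lemma Re_iS k : complex.Re ('i ^+ k.+1 : R[i])%C = - complex.Im ('i ^+ k : R[i])%C.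
Proof. by rewrite exprS; case: ('i ^+ k)%C => a b /=; ring. Qed.

Lemma Im_iS k : complex.Im ('i ^+ k.+1 : R[i])%C = complex.Re ('i ^+ k : R[i])%C.
Proof. by rewrite exprS; case: ('i ^+ k)%C => a b /=; ring. Qed.

Lemma fact_mulr_cancel (a : R) k : a / k.+1`!%:R *+ k.+1 = a / k`!%:R.
Proof.
have k0 : k`!%:R != 0 :> R by rewrite pnatr_eq0 -lt0n fact_gt0.
have k1 : k.+1%:R != 0 :> R by rewrite pnatr_eq0.
rewrite factS natrM -mulr_natr; move: k0 k1.
by move: k.+1%:R k`!%:R => u v v0 u0; field; rewrite u0 v0.
Qed.

Lemma deriv_cosT n : deriv (cosT n.+1) = - sinT n.
Proof.
apply/polyP => k; rewrite coef_deriv coefN !coef_poly ltnS.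
case: ifP => _; last by rewrite mul0rn oppr0.
by rewrite fact_mulr_cancel Re_iS mulNr.
Qed.

Lemma deriv_sinT n : deriv (sinT n.+1) = cosT n.
Proof.
apply/polyP => k; rewrite coef_deriv !coef_poly ltnS.
case: ifP => _; last by rewrite mul0rn.
by rewrite fact_mulr_cancel Im_iS.
Qed.

(** Both bounds are proved together: the derivative of each remainder of order [n + 1] is, up to
    sign, the other remainder of order [n]. *)
Lemma cos_sin_taylor n t :
  `|cos t - (cosT n).[t]| <= `|t| ^+ n /\ `|sin t - (sinT n).[t]| <= `|t| ^+ n.
Proof.
elim: n t => [|n IH] t.
  rewrite /cosT /sinT !poly_def !big_ord0 !horner0 !subr0 expr0.
  by rewrite !ler_norml cos_geN1 cos_le1 sin_geN1 sin_le1.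
split.
- apply: (@primitive_bound (fun t => cos t - (cosT n.+1).[t])
      (fun t => - sin t - (- sinT n).[t])).
  + by move=> x; rewrite -deriv_cosT; exact: is_deriveB.
  + by rewrite cos0 horner_coef0 coef_poly /= invr1 mulr1 subrr.
  + by move=> x; rewrite hornerN -opprD normrN; have [] := IH x.
- apply: (@primitive_bound (fun t => sin t - (sinT n.+1).[t])
      (fun t => cos t - (cosT n).[t])).
  + by move=> x; rewrite -deriv_sinT; exact: is_deriveB.
  + by rewrite sin0 horner_coef0 coef_poly /= mul0r subrr.
  + by move=> x; have [] := IH x.
Qed.

(** The constant [2] comes from bounding the modulus by the sum of the real and imaginary
    remainders. *)
Lemma cis_taylor n t :
  normc (cis t - \sum_(k < n) 'i%C ^+ k * (t ^+ k / k`!%:R)%:C%C)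
    <= 2 * `|t| ^+ n.
Proof.
have -> : \sum_(k < n) 'i%C ^+ k * (t ^+ k / k`!%:R)%:C%C =
    ((cosT n).[t] +i* (sinT n).[t])%C :> R[i].
  rewrite /cosT /sinT !horner_poly; elim: n => [|n IH]; first by rewrite !big_ord0.
  rewrite !big_ord_recr /= IH; case: ('i ^+ n)%C => a b.
  by apply/eqP; rewrite eq_complex /=; apply/andP; split; apply/eqP; ring.
apply: (le_trans (normc_le_ReIm _)) => /=.
by have [] := cos_sin_taylor n t; lra.
Qed.

End taylor.

(** * Bang's argument *)

Section bang.
Context {R : realType}.
(** [Q j t b] stands for: the [j]-th derivative at [t] is bounded by [b]. It stays abstract because
    it will be an upper bound for an [L_p]-distance, where only a Taylor inequality is available. *)
Variables (Q : nat -> R -> R -> Prop) (m : nat -> R) (C : R).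
Let M j := C * \prod_(k < j) m k.
Hypothesis C0 : 0 < C.
Hypothesis m_gt0 : forall k, 0 < m k.
Hypothesis m_mono : forall k l, (k <= l)%N -> m k <= m l.
Hypothesis m_div : forall B : R, exists N, B <= \sum_(k < N) (m k)^-1.
Hypothesis Q_le : forall j t b b', b <= b' -> Q j t b -> Q j t b'.
Hypothesis Q_M : forall j t, Q j t (M j).
Hypothesis Q_taylor : forall j L t h (b : nat -> R), 0 <= h ->
  (forall i, (i < L)%N -> Q (j + i)%N t (b i)) ->
  Q j (t + h) (\sum_(i < L) h ^+ i * b i + 2 * h ^+ L * M (j + L)).
Hypothesis Q0 : forall j, Q j 0 0.

Let M_gt0 j : 0 < M j.
Proof. by rewrite mulr_gt0// prodr_gt0. Qed.

(** Only the orders [j < N] carry information: for [j >= N] the bound is at least [M j], which [Q_M]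
    grants everywhere. *)
Let H N t := forall j, Q j t (2 ^+ j * M j / 2 ^+ N).

(** [M] is log-convex: its successive ratios are the [m k], and those occurring here have
    [k <= N]. *)
Let M_le N j i : (j + i <= N.+1)%N -> M (j + i) <= M j * m N ^+ i.
Proof.
elim: i => [|i IH] ji; first by rewrite addn0 expr0 mulr1.
have -> : M (j + i.+1) = M (j + i) * m (j + i).
  by rewrite /M addnS big_ord_recr/= mulrA.
rewrite exprSr mulrA ler_pM ?(ltW (M_gt0 _)) ?(ltW (m_gt0 _))//.
  by apply: IH; rewrite ltnW// -addnS.
by apply: m_mono; rewrite addnS ltnS in ji.
Qed.

(** At [x = 1 / 2] this is an equality for every [L]; the factor [2] on the remainder term is
    exactly what the induction tolerates. *)
Let geom_bound (x : R) L : 0 <= x <= 2^-1 ->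
  \sum_(i < L) x ^+ i + 2 * x ^+ L <= 2.
Proof.
move=> /andP[x0 x2]; elim: L => [|L IH]; first by rewrite big_ord0 expr0; lra.
rewrite big_ord_recr /= exprS; have : 0 <= x ^+ L by rewrite exprn_ge0.
by nra.
Qed.

(** The step size makes [x = 2 * m N * h] at most [1 / 2]. The Taylor inequality then becomes a
    geometric sum of value at most [2], which is the factor lost in passing from [N + 1] to [N]. *)
Let step N t h : 0 <= h -> h <= (4 * m N)^-1 -> H N.+1 t -> H N (t + h).
Proof.
move=> h0 hm HN j.
have two_gt0 k : 0 < 2 ^+ k :> R by rewrite exprn_gt0.
have [jN|Nj] := leqP j N; last first.
  apply: Q_le (Q_M _ _); rewrite mulrAC ler_peMl//; first exact: ltW.
  rewrite ler_pdivlMr// mul1r; apply: ler_weXn2l; first by lra.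
  exact: ltnW.
(* The expansion stops at order [N + 1], where [2 ^ (j + L) / 2 ^ (N + 1) = 1], so the remainder
   takes the same shape as the other terms. *)
have [L jL] : exists L, (j + L = N.+1)%N by exists (N.+1 - j)%N; rewrite subnKC// ltnW.
have := Q_taylor (j := j) (L := L) (t := t) h0 (fun i _ => HN (j + i)%N).
apply: Q_le; rewrite jL.
set x := 2 * m N * h.
have x0 : 0 <= x by rewrite !mulr_ge0// ltW.
have x2 : x <= 2^-1.
  rewrite /x; move: hm; rewrite -[(4 * m N)^-1]mul1r ler_pdivlMr; last first.
    by rewrite mulr_gt0.
  by nra.
have := geom_bound (x := x) L; rewrite x0 x2 => /(_ isT) gb.
set K := 2 ^+ j * M j / 2 ^+ N.+1.
have K0 : 0 < K by rewrite divr_gt0// mulr_gt0.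
apply: (@le_trans _ _ (K * (\sum_(i < L) x ^+ i + 2 * x ^+ L))); last first.
  apply: le_trans (ler_wpM2l (ltW K0) gb) _.
  rewrite /K exprS le_eqVlt; apply/orP; left; apply/eqP.
  by field; rewrite lt0r_neq0.
rewrite mulrDr mulr_sumr; apply: lerD.
  apply: ler_sum => -[i iL] _ /=.
  have -> : K * x ^+ i = h ^+ i * (2 ^+ (j + i) * (M j * m N ^+ i) / 2 ^+ N.+1).
    by rewrite /K /x !exprMn exprD; ring.
  rewrite ler_wpM2l ?exprn_ge0// ler_wpM2r ?invr_ge0 ?(ltW (two_gt0 _))//.
  by rewrite ler_wpM2l ?(ltW (two_gt0 _))// M_le// -jL leq_add2l ltnW.
have -> : K * (2 * x ^+ L) = 2 * h ^+ L * (M j * m N ^+ L) * (2 ^+ (j + L) / 2 ^+ N.+1).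
  by rewrite /K /x !exprMn exprD; ring.
rewrite jL mulfV ?lt0r_neq0// mulr1 ler_wpM2l//; last by rewrite -jL M_le ?jL.
by rewrite mulr_ge0// exprn_ge0.
Qed.

(** The path from [0] to [t] starts at level at most [K + d] and descends to [K], the step into
    level [k] having length at most [1 / (4 m k)]. *)
Let reach d K t : 0 <= t -> t <= \sum_(i < d) (4 * m (K + i)%N)^-1 -> H K t.
Proof.
elim: d K t => [|d IH] K t t0.
  rewrite big_ord0 => tle0; have -> : t = 0 by apply: le_anti; rewrite t0 tle0.
  move=> j; apply: Q_le (Q0 j).
  by rewrite divr_ge0 ?exprn_ge0// mulr_ge0 ?exprn_ge0// ltW.
rewrite big_ord_recl /= addn0 => tle.
have mK0 : 0 < (4 * m K)^-1 by rewrite invr_gt0 mulr_gt0.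
have tle' : t - (4 * m K)^-1 <= \sum_(i < d) (4 * m (K.+1 + i)%N)^-1.
  rewrite lerBlDl; apply: le_trans tle _; rewrite lerD2l.
  by apply: ler_sum => i _; rewrite addSnnS.
have [tm|mt] := leP t (4 * m K)^-1.
  rewrite -[t]add0r; apply: step => //; apply: IH => //.
  by apply: sumr_ge0 => i _; rewrite invr_ge0 mulr_ge0// ltW.
rewrite -[t](subrK (4 * m K)^-1); apply: step => //; first exact: ltW.
by apply: IH; rewrite // subr_ge0 ltW.
Qed.

(* Bang's proof of the Denjoy-Carleman theorem: the bounds [2 ^ j * M j / 2 ^ N]
   hold at [0] for all [N], and moving by [1 / (4 m N)] costs one unit of [N];
   since [sum 1 / m] diverges, any [t] is reached with [N] still arbitrarily
   large. *)
Lemma bang t e : 0 <= t -> 0 < e -> Q 0 t e.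
Proof.
move=> t0 e0.
have HK K : H K t.
  (* The sum over [k < K] is added so that the terms from [K] on still exceed [4 * t]. *)
  have [N hN] := m_div (4 * t + \sum_(k < K) (m k)^-1).
  have [NK|KN] := leqP N K.
    apply: (reach (d := 0)) => //; rewrite big_ord0.
    have : \sum_(k < N) (m k)^-1 <= \sum_(k < K) (m k)^-1.
      have [d ->] : exists d, K = (N + d)%N by exists (K - N)%N; rewrite subnKC.
      rewrite big_split_ord /= lerDl sumr_ge0// => i _.
      by rewrite invr_ge0 ltW.
    by lra.
  apply: (reach (d := N - K)) => //.
  move: hN; have [d ->] : exists d, N = (K + d)%N.
    by exists (N - K)%N; rewrite subnKC// ltnW.
  rewrite big_split_ord /= [4 * t + _]addrC lerD2l addKn => hN.
  under eq_bigr do rewrite invfM.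
  by rewrite -mulr_sumr; lra.
have [K hK] : exists K, M 0 / 2 ^+ K <= e.
  have [k hk] : exists k, M 0 / e < k%:R.
    by exists (Num.bound (M 0 / e)); apply: archi_boundP; rewrite divr_ge0 ?ltW.
  exists k; rewrite ler_pdivrMr ?exprn_gt0//.
  move: hk; rewrite ltr_pdivrMr// mulrC => /ltW/le_trans; apply.
  rewrite ler_wpM2l ?(ltW e0)// -natrX ler_nat ltnW//.
  exact: ltn_expl.
by apply: Q_le (HK K 0%N); rewrite expr0 mul1r.
Qed.

End bang.

(** * Distance and closure in L_p *)

Section Lp_seminorm.
Context {d : measure_display} {T : measurableType d} {R : realType}.
Implicit Types (f g h : T -> R[i]).

Lemma cmeasurableD f g : cmeasurable f -> cmeasurable g ->
  cmeasurable (fun x => f x + g x).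
Proof.
move=> [f1 f2] [g1 g2]; split.
  have -> : (fun x => complex.Re (f x + g x)) =
    (fun x => complex.Re (f x)) \+ (fun x => complex.Re (g x)).
    by apply/funext => x /=; case: (f x) (g x) => ? ? [].
  exact: measurable_funD.
have -> : (fun x => complex.Im (f x + g x)) =
  (fun x => complex.Im (f x)) \+ (fun x => complex.Im (g x)).
  by apply/funext => x /=; case: (f x) (g x) => ? ? [].
exact: measurable_funD.
Qed.

Lemma cmeasurableM f g : cmeasurable f -> cmeasurable g ->
  cmeasurable (fun x => f x * g x).
Proof.
move=> [f1 f2] [g1 g2]; split.
  have -> : (fun x => complex.Re (f x * g x)) =
    (fun x => complex.Re (f x) * complex.Re (g x) - complex.Im (f x) * complex.Im (g x)).
    by apply/funext => x /=; case: (f x) (g x) => ? ? [].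
  by apply: measurable_funB; exact: measurable_funM.
have -> : (fun x => complex.Im (f x * g x)) =
  (fun x => complex.Re (f x) * complex.Im (g x) + complex.Im (f x) * complex.Re (g x)).
  by apply/funext => x /=; case: (f x) (g x) => ? ? [].
by apply: measurable_funD; exact: measurable_funM.
Qed.

Lemma cmeasurable_cst (c : R[i]) : cmeasurable (fun _ : T => c).
Proof. by split; exact: measurable_cst. Qed.

Lemma cmeasurableN f : cmeasurable f -> cmeasurable (fun x => - f x).
Proof.
move=> mf; have -> : (fun x => - f x) = (fun x => (-1) * f x).
  by apply/funext => x; rewrite mulN1r.
exact/cmeasurableM/mf/cmeasurable_cst.
Qed.

Lemma cmeasurableB f g : cmeasurable f -> cmeasurable g ->
  cmeasurable (fun x => f x - g x).
Proof. by move=> mf mg; apply: cmeasurableD => //; exact: cmeasurableN. Qed.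

Lemma cmeasurableR (f : T -> R) : measurable_fun setT f ->
  cmeasurable (fun x => (f x)%:C%C).
Proof. by move=> mf; split => //; exact: measurable_cst. Qed.

Lemma cmeasurable_sum n (f : 'I_n -> T -> R[i]) : (forall i, cmeasurable (f i)) ->
  cmeasurable (fun x => \sum_(i < n) f i x).
Proof.
elim: n f => [|n IH] f mf.
  by under eq_fun do rewrite big_ord0; exact: cmeasurable_cst.
by under eq_fun do rewrite big_ord_recl /=; apply: cmeasurableD => //; exact: IH.
Qed.

Lemma measurable_normc f : cmeasurable f -> measurable_fun setT (fun x => normc (f x)).
Proof.
move=> [f1 f2].
have -> : (fun x => normc (f x)) =
    (fun x => (complex.Re (f x) ^+ 2 + complex.Im (f x) ^+ 2) `^ 2^-1).
  apply/funext => x /=; case: (f x) => a b /=.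
  by rewrite powR12_sqrt// addr_ge0// sqr_ge0.
apply: (@measurableT_comp _ _ _ _ _ _ (@powR R ^~ 2^-1)) => //.
by apply: measurable_funD; exact: measurable_funX.
Qed.

Context (mu : {measure set T -> \bar R}) (p : R).
Hypothesis p1 : 1 <= p.
Let p0 : 0 < p. Proof. exact: lt_le_trans p1. Qed.

Local Notation N := (cLnorm mu p).

Definition Lp_integral f : \bar R := (\int[mu]_x (normc (f x) `^ p)%:E)%E.

Lemma cLnormE f : N f = (Lp_integral f `^ p^-1)%E.
Proof.
rewrite /cLnorm unlock /=; congr poweR; apply: eq_integral => x _.
by rewrite ger0_norm ?normc_ge0.
Qed.

Lemma Lp_integral_ge0 f : (0 <= Lp_integral f)%E.
Proof. by apply: integral_ge0 => x _; rewrite lee_fin powR_ge0. Qed.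

Lemma measurable_normc_powR f : cmeasurable f ->
  measurable_fun setT (fun x => normc (f x) `^ p).
Proof.
move=> mf; apply: (@measurableT_comp _ _ _ _ _ _ (@powR R ^~ p)) => //.
exact: measurable_normc.
Qed.

Lemma cLnorm_le f c : 0 <= c -> (Lp_integral f <= (c `^ p)%:E)%E -> (N f <= c%:E)%E.
Proof.
move=> c0 H; rewrite cLnormE.
have -> : c%:E = ((c `^ p)%:E `^ p^-1)%E.
  by rewrite poweR_EFin -powRrM mulfV ?gt_eqF// powRr1.
apply: gt0_ler_poweR => //; rewrite ?invr_ge0 ?ltW//.
  by rewrite in_itv/= leey Lp_integral_ge0.
by rewrite in_itv/= leey lee_fin powR_ge0.
Qed.

Lemma cLnorm_ge0 f : (0 <= N f)%E.
Proof. exact: Lnorm_ge0. Qed.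

Lemma Lp_integral_lty f : (N f < +oo)%E -> (Lp_integral f < +oo)%E.
Proof. by rewrite cLnormE; apply: lty_poweRy; rewrite invr_eq0 gt_eqF. Qed.

Lemma cLnorm_lty f : (Lp_integral f < +oo)%E -> (N f < +oo)%E.
Proof. by rewrite cLnormE; exact: poweR_lty. Qed.

Lemma cLnorm_mono f (g : T -> R) : cmeasurable f -> measurable_fun setT g ->
  (forall x, normc (f x) <= g x) -> (N f <= N (fun x => (g x)%:C%C))%E.
Proof.
move=> mf mg fg.
have g0 x : 0 <= g x by apply: le_trans (fg x); exact: normc_ge0.
rewrite !cLnormE; apply: gt0_ler_poweR; rewrite ?invr_ge0 ?(ltW p0)//.
  by rewrite in_itv/= Lp_integral_ge0 leey.
  by rewrite in_itv/= Lp_integral_ge0 leey.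
apply: ge0_le_integral => //.
- by move=> x _; rewrite lee_fin powR_ge0.
- by apply/measurable_EFinP; exact: measurable_normc_powR.
- by apply/measurable_EFinP; apply: measurable_normc_powR; exact: cmeasurableR.
- move=> x _; rewrite lee_fin normcR ger0_norm//.
  by apply: ge0_ler_powR; rewrite ?nnegrE ?normc_ge0 ?(ltW p0).
Qed.

Lemma cLnormD f g : cmeasurable f -> cmeasurable g ->
  (N (fun x => (f x + g x)%R) <= N f + N g)%E.
Proof.
move=> mf mg.
have H := minkowski_EFin mu (measurable_normc mf) (measurable_normc mg) p1.
apply: le_trans H.
have mn : measurable_fun setT ((fun x => normc (f x)) \+ (fun x => normc (g x))).
  by apply: measurable_funD; exact: measurable_normc.
apply: le_trans (cLnorm_mono (cmeasurableD mf mg) mn _) _ => [x|].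
  exact: normcD.
rewrite /cLnorm le_eqVlt; apply/orP; left; apply/eqP; apply: eq_Lnorm => x /=.
by rewrite expr0n addr0 sqrtr_sqr ger0_norm// addr_ge0 ?normc_ge0.
Qed.

Lemma cLnormZ f c : cmeasurable f -> N (fun x => c * f x) = ((normc c)%:E * N f)%E.
Proof.
move=> mf; rewrite !cLnormE /Lp_integral.
under eq_integral do rewrite ComplexField.Normc.normcM powRM ?normc_ge0// EFinM.
rewrite ge0_integralZl_EFin ?powR_ge0//; last 2 first.
  by move=> x _; rewrite lee_fin powR_ge0.
  by apply/measurable_EFinP; exact: measurable_normc_powR.
rewrite poweRM ?lee_fin ?powR_ge0 ?Lp_integral_ge0//.
by rewrite poweR_EFin -powRrM mulfV ?gt_eqF// powRr1// normc_ge0.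
Qed.

(** Dominated convergence for the [p]-th powers of the differences, with dominating function
    [G ^ p]. *)
Lemma cLnorm_dominated (fk : nat -> T -> R[i]) f (G : T -> R) :
  (forall k, cmeasurable (fk k)) -> cmeasurable f ->
  measurable_fun setT G ->
  (N (fun x => (G x)%:C%C) < +oo)%E ->
  (forall k x, normc (fk k x - f x) <= G x) ->
  (forall x, normc (fk k x - f x) @[k --> \oo] --> (0 : R)) ->
  forall e, 0 < e -> exists k, (N (fun x => (f x - fk k x)%R) < e%:E)%E.
Proof.
move=> mfk mf mG Gy dom lim e e0.
have G0 x : 0 <= G x by apply: le_trans (dom 0%N x); exact: normc_ge0.
have mG' := measurable_normc_powR (cmeasurableR mG).
have mk k := measurable_normc_powR (cmeasurableB (mfk k) mf).
have [_ _ H] : [/\ mu.-integrable setT (cst 0%E),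
    [sequence (\int[mu]_x `|(normc (fk k x - f x) `^ p)%:E - cst 0 x|)%E]_k
      @ \oo --> 0%E &
    [sequence (\int[mu]_x (normc (fk k x - f x) `^ p)%:E)%E]_k @ \oo -->
      (\int[mu]_x cst 0 x)%E].
  apply: (@dominated_convergence _ _ _ _ _ _ _ _ (fun x => (normc (G x)%:C%C `^ p)%:E)).
  - exact: measurableT.
  - by move=> k; apply/measurable_EFinP; exact: mk.
  - exact: measurable_cst.
  - apply: aeW => x _; apply: cvg_EFin; first by exact: nearW.
    apply/cvgrPdist_lt => r r0 /=.
    (* Below [1] a [p]-th power is at most its base because [p >= 1]; the minimum with [1] makes
       this applicable. *)
    have : \forall k \near \oo, normc (fk k x - f x) < Num.min r 1.
      have /cvgrPdist_lt/(_ (Num.min r 1)) := lim x.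
      rewrite lt_min r0 ltr01 => /(_ isT); apply: filterS => k /=.
      by rewrite sub0r normrN ger0_norm ?normc_ge0.
    apply: filterS => k; rewrite lt_min => /andP[kr k1].
    rewrite sub0r normrN ger0_norm ?powR_ge0//; apply: le_lt_trans kr.
    have := normc_ge0 (fk k x - f x); rewrite le_eqVlt => /predU1P[<-|k0].
      by rewrite powR0// gt_eqF.
    by apply: ge1r_powR => //; rewrite k0 ltW.
  - apply/integrableP; split; first exact/measurable_EFinP.
    under eq_integral do rewrite gee0_abs ?lee_fin ?powR_ge0//.
    exact: Lp_integral_lty.
  - apply: aeW => x k _; rewrite lee_fin ger0_norm ?powR_ge0// normcR ger0_norm//.
    by apply: ge0_ler_powR; rewrite ?nnegrE ?normc_ge0 ?(ltW p0).
move: H; rewrite integral0 => /fine_cvgP[Hfin /cvgrPdist_lt H].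
have e2 : 0 < e / 2 by rewrite divr_gt0.
have [k _ /(_ k (leqnn k)) /= [kfin]] := filterI Hfin (H _ (powR_gt0 p e2)).
rewrite sub0r normrN ger0_norm ?fine_ge0 ?Lp_integral_ge0// => /ltW klt.
exists k; apply: (@le_lt_trans _ _ (e / 2)%:E); last first.
  by rewrite lte_fin ltr_pdivrMr// ltr_pMr// ltr1n.
apply: cLnorm_le; first exact: ltW.
move: klt; rewrite -lee_fin fineK// => klt; apply: (le_trans _ klt).
rewrite /Lp_integral le_eqVlt; apply/orP; left; apply/eqP.
by apply: eq_integral => x _; rewrite -normcN opprB.
Qed.

Section distance.
Variable F : set (T -> R[i]).

(* Upper bounds for the distance to [F] suffice, so no infimum is formed. *)
Definition Lp_dist_le f b := forall e, 0 < e ->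
  exists2 g, F g & (N (fun x => (f x - g x)%R) < (b + e)%:E)%E.

Hypothesis F0 : F (fun=> 0).
Hypothesis FD : forall f g, F f -> F g -> F (fun x => f x + g x).
Hypothesis FZ : forall c f, F f -> F (fun x => c * f x).
Hypothesis Fm : forall f, F f -> cmeasurable f.

Lemma cLnorm_cst0 : N (fun=> 0) = 0%E.
Proof.
have := cLnormZ 0 (cmeasurable_cst 0).
by under eq_fun do rewrite mul0r; rewrite ComplexField.Normc.normc0 mul0e.
Qed.

Lemma Lp_dist_ge0 f b : Lp_dist_le f b -> 0 <= b.
Proof.
move=> H; apply/ler_addgt0Pr => e e0; have [g _ /ltW] := H e e0.
by move=> /(le_trans (cLnorm_ge0 _)); rewrite lee_fin.
Qed.

Lemma Lp_dist_mem f : F f -> Lp_dist_le f 0.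
Proof.
move=> Ff e e0; exists f => //; under eq_fun do rewrite subrr.
by rewrite cLnorm_cst0 lte_fin add0r.
Qed.

Lemma Lp_dist_norm f b : (N f <= b%:E)%E -> Lp_dist_le f b.
Proof.
move=> Nf e e0; exists (fun=> 0) => //; under eq_fun do rewrite subr0.
by apply: le_lt_trans Nf _; rewrite lte_fin ltrDl.
Qed.

Lemma Lp_dist_weak f b b' : b <= b' -> Lp_dist_le f b -> Lp_dist_le f b'.
Proof.
move=> bb' H e /H[g Fg Ng]; exists g => //; apply: lt_le_trans Ng _.
by rewrite lee_fin lerD2r.
Qed.

Lemma Lp_distD f1 f2 b1 b2 : cmeasurable f1 -> cmeasurable f2 ->
  Lp_dist_le f1 b1 -> Lp_dist_le f2 b2 ->
  Lp_dist_le (fun x => f1 x + f2 x) (b1 + b2).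
Proof.
move=> m1 m2 H1 H2 e e0; have e2 : 0 < e / 2 by rewrite divr_gt0.
have [g1 Fg1 N1] := H1 _ e2; have [g2 Fg2 N2] := H2 _ e2.
exists (fun x => g1 x + g2 x); first exact: FD.
have -> : (fun x => f1 x + f2 x - (g1 x + g2 x)) =
    (fun x => (f1 x - g1 x) + (f2 x - g2 x)).
  by apply/funext => x; rewrite opprD addrACA.
apply: le_lt_trans (cLnormD _ _) _; try by apply: cmeasurableB => //; exact: Fm.
have -> : (b1 + b2 + e)%:E = ((b1 + e / 2)%:E + (b2 + e / 2)%:E)%E.
  by rewrite -EFinD; congr EFin; lra.
by apply: lteD.
Qed.

Lemma Lp_distZ f c b : cmeasurable f -> Lp_dist_le f b ->
  Lp_dist_le (fun x => c * f x) (normc c * b).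
Proof.
(* For [c = 0] the tolerance [e / normc c] used below would be [0], so the zero function serves as
   approximant. *)
move=> mf H e e0; have [c0|c0] := eqVneq (normc c) 0.
  exists (fun=> 0) => //; have -> : c = 0 by exact: ComplexField.Normc.eq0_normc.
  under eq_fun do rewrite mul0r subr0.
  by rewrite cLnorm_cst0 ComplexField.Normc.normc0 mul0r add0r lte_fin.
have cgt0 : 0 < normc c by rewrite lt0r c0 normc_ge0.
have [g Fg Ng] := H (e / normc c) (divr_gt0 e0 cgt0).
exists (fun x => c * g x); first exact: FZ.
have -> : (fun x => c * f x - c * g x) = (fun x => c * (f x - g x)).
  by apply/funext => x; rewrite mulrBr.
rewrite cLnormZ; last by apply: cmeasurableB => //; exact: Fm.
have -> : (normc c * b + e)%:E = ((normc c)%:E * (b + e / normc c)%:E)%E.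
  by rewrite -EFinM; congr EFin; field.
by rewrite lte_pmul2l.
Qed.

Lemma Lp_dist_sum n (f : 'I_n -> T -> R[i]) (b : 'I_n -> R) :
  (forall i, cmeasurable (f i)) -> (forall i, Lp_dist_le (f i) (b i)) ->
  Lp_dist_le (fun x => \sum_(i < n) f i x) (\sum_(i < n) b i).
Proof.
elim: n f b => [|n IH] f b mf H.
  by under eq_fun do rewrite big_ord0; rewrite big_ord0; exact: Lp_dist_mem.
under eq_fun do rewrite big_ord_recl /=; rewrite big_ord_recl.
apply: Lp_distD => //; first by apply: cmeasurable_sum.
exact: IH.
Qed.

(** Measurability is built in because Minkowski's inequality is applied to these functions. *)
Definition Lp_closure f := cmeasurable f /\ Lp_dist_le f 0.

Lemma Lp_closure_mem f : F f -> Lp_closure f.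
Proof. by move=> Ff; split; [exact: Fm|exact: Lp_dist_mem]. Qed.

Lemma Lp_closureD f g : Lp_closure f -> Lp_closure g ->
  Lp_closure (fun x => f x + g x).
Proof.
move=> [mf Hf] [mg Hg]; split; first exact: cmeasurableD.
by rewrite -[0]addr0; exact: Lp_distD.
Qed.

Lemma Lp_closureZ c f : Lp_closure f -> Lp_closure (fun x => c * f x).
Proof.
move=> [mf Hf]; split; first exact/cmeasurableM/mf/cmeasurable_cst.
by rewrite -(mulr0 (normc c)); exact: Lp_distZ.
Qed.

Lemma Lp_closureB f g : Lp_closure f -> Lp_closure g ->
  Lp_closure (fun x => f x - g x).
Proof.
move=> Hf /(Lp_closureZ (-1)) /(Lp_closureD Hf).
by under eq_fun do rewrite mulN1r.
Qed.

Lemma Lp_closure_sum n (f : 'I_n -> T -> R[i]) : (forall i, Lp_closure (f i)) ->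
  Lp_closure (fun x => \sum_(i < n) f i x).
Proof.
move=> H; split; first by apply: cmeasurable_sum => i; case: (H i).
rewrite [X in Lp_dist_le _ X](_ : 0 = \sum_(i < n) 0); last by rewrite big1.
by apply: (@Lp_dist_sum _ _ (fun=> 0)) => i; case: (H i).
Qed.

Lemma Lp_closure_lim f : cmeasurable f ->
  (forall e, 0 < e -> exists2 g, Lp_closure g &
     (N (fun x => (f x - g x)%R) <= e%:E)%E) -> Lp_closure f.
Proof.
move=> mf H; split=> // e e0; have e3 : 0 < e / 3 by rewrite divr_gt0.
have [g [mg Hg] Ng] := H _ e3; have [h Fh Nh] := Hg _ e3.
exists h => //.
have -> : (fun x => f x - h x) = (fun x => (f x - g x) + (g x - h x)).
  by apply/funext => x; rewrite addrA subrK.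
apply: le_lt_trans (cLnormD _ _) _; try by apply: cmeasurableB => //; exact: Fm.
apply: (@le_lt_trans _ _ ((e / 3)%:E + (0 + e / 3)%:E)%E).
  by apply: leeD => //; exact: ltW.
by rewrite -EFinD lte_fin; lra.
Qed.

Lemma Lp_closure_dominated (fk : nat -> T -> R[i]) f (G : T -> R) :
  (forall k, Lp_closure (fk k)) -> cmeasurable f -> measurable_fun setT G ->
  (N (fun x => (G x)%:C%C) < +oo)%E ->
  (forall k x, normc (fk k x - f x) <= G x) ->
  (forall x, normc (fk k x - f x) @[k --> \oo] --> (0 : R)) ->
  Lp_closure f.
Proof.
move=> Hfk mf mG Gy dom lim; apply: Lp_closure_lim => // e e0.
have [|k Hk] := cLnorm_dominated _ mf mG Gy dom lim e0.
  by move=> k; case: (Hfk k).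
by exists (fk k) => //; exact: ltW.
Qed.

End distance.

End Lp_seminorm.

(** * From indicators of measurable sets to all of [L_p] *)

Section indicators_generate.
Import HBNNSimple.
Context {d : measure_display} {T : measurableType d} {R : realType}.
Variables (mu : {measure set T -> \bar R}) (p : R) (F : set (T -> R[i])).
Hypothesis p1 : 1 <= p.
Hypothesis F0 : F (fun=> 0).
Hypothesis FD : forall f g, F f -> F g -> F (fun x => f x + g x).
Hypothesis FZ : forall c f, F f -> F (fun x => c * f x).
Hypothesis Fm : forall f, F f -> cmeasurable f.
Local Notation cl := (Lp_closure mu p F).
Hypothesis F_indic : forall A, measurable A -> cl (fun x => (\1_A x)%:C%C).

Let clD := @Lp_closureD _ _ _ mu _ p1 _ FD Fm.
Let clZ := @Lp_closureZ _ _ _ mu _ p1 _ F0 FZ Fm.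
Let clB := @Lp_closureB _ _ _ mu _ p1 _ F0 FD FZ Fm.

Let cl_simple (g : {nnsfun T >-> R}) : cl (fun x => (g x)%:C%C).
Proof.
under eq_fun do rewrite fimfunE fsbig_finite//.
elim: (finmap.enum_fset _) => [|y s IH].
  by under eq_fun do rewrite big_nil; exact: (Lp_closure_mem _ p1 Fm F0).
under eq_fun do rewrite big_cons rmorphD rmorphM /=.
by apply: clD => //; apply: clZ; exact: F_indic.
Qed.

(** An increasing sequence of simple functions [g k] tends to [f], and [0 <= f - g k <= f] makes [f]
    itself the dominating function. *)
Let cl_nneg (f : T -> R) : measurable_fun setT f -> (forall x, 0 <= f x) ->
  (cLnorm mu p (fun x => (f x)%:C%C) < +oo)%E -> cl (fun x => (f x)%:C%C).
Proof.
move=> mf f0 fy.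
have mEf : measurable_fun setT (EFin \o f) by exact/measurable_EFinP.
pose g := nnsfun_approx measurableT mEf.
have gf x : g ^~ x @ \oo --> f x.
  have : EFin \o (g ^~ x) @ \oo --> (EFin \o f) x.
    by apply: cvg_nnsfun_approx => // y _; rewrite lee_fin.
  by move=> /fine_cvg.
have gle k x : g k x <= f x.
  have ndx : nondecreasing_seq (g ^~ x).
    by move=> i j ij; have /lefP := nd_nnsfun_approx measurableT mEf ij; apply.
  rewrite -(cvg_lim _ (gf x))//; apply: nondecreasing_cvgn_le => //.
  by apply/cvg_ex; exists (f x); exact: gf.
apply: (Lp_closure_dominated p1 Fm (fk := fun k x => (g k x)%:C%C) (G := f)) => //.
- move=> k x; rewrite -rmorphB normcR distrC ger0_norm ?subr_ge0//.
  by rewrite gerBl.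
- move=> x; under eq_fun do rewrite -rmorphB normcR.
  apply/norm_cvg0P.
  by rewrite -(subrr (f x)); apply: cvgB; [exact: gf|exact: cvg_cst].
Qed.

Let cl_real (f : T -> R) : measurable_fun setT f ->
  (cLnorm mu p (fun x => (f x)%:C%C) < +oo)%E -> cl (fun x => (f x)%:C%C).
Proof.
move=> mf fy.
have absf (g : T -> R) : measurable_fun setT g -> (forall x, `|g x| <= `|f x|) ->
    (cLnorm mu p (fun x => (g x)%:C%C) < +oo)%E.
  move=> mg gf; apply: le_lt_trans fy.
  apply: (@le_trans _ _ (cLnorm mu p (fun x => (`|f x|)%:C%C))).
    apply: (cLnorm_mono _ p1).
    - exact: cmeasurableR.
    - exact: measurableT_comp.
    - by move=> x; rewrite normcR.
  by rewrite /cLnorm; under eq_fun do rewrite normcR normr_id -normcR.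
have -> : (fun x => (f x)%:C%C) = (fun x => (f^\+ x)%:C%C - (f^\- x)%:C%C).
  by apply/funext => x; rewrite -rmorphB -[in LHS](funrposBneg f).
have fnorm x : f^\+ x + f^\- x = `|f x| by have /(congr1 (@^~ x)) := funrposDneg f.
have f1 := funrpos_ge0 f; have f2 := funrneg_ge0 f.
apply: clB; apply: cl_nneg => //.
- exact: measurable_funrpos.
- apply: absf; first exact: measurable_funrpos.
  by move=> x; rewrite -fnorm ger0_norm// lerDl.
- exact: measurable_funrneg.
- apply: absf; first exact: measurable_funrneg.
  by move=> x; rewrite -fnorm ger0_norm// lerDr.
Qed.

(** Real and imaginary parts, and then their positive and negative parts, are dominated by the
    modulus of [f], hence have finite norm. *)
Lemma Lp_closure_full (f : T -> R[i]) : inLp mu p f -> cl f.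
Proof.
move=> [mf fy].
have -> : f = (fun x => (complex.Re (f x))%:C%C + 'i%C * (complex.Im (f x))%:C%C).
  by apply/funext => x; case: (f x) => a b; apply/eqP;
    rewrite eq_complex /=; apply/andP; split; apply/eqP; ring.
have part (g : T -> R) : measurable_fun setT g -> (forall x, `|g x| <= normc (f x)) ->
    cl (fun x => (g x)%:C%C).
  move=> mg gf; apply: cl_real => //; apply: le_lt_trans fy.
  apply: (@le_trans _ _ (cLnorm mu p (fun x => (normc (f x))%:C%C))).
    apply: (cLnorm_mono _ p1).
    - exact: cmeasurableR.
    - exact: measurable_normc.
    - by move=> x; rewrite normcR.
  by rewrite /cLnorm; under eq_fun do rewrite normcR ger0_norm ?normc_ge0//.
case: mf => mRe mIm; apply: clD; last apply: clZ; apply: part => // x.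
  exact: Re_le_normc.
exact: Im_le_normc.
Qed.

End indicators_generate.

(** * Trigonometric polynomials and the Borel sets *)

Section sign_iterates.
Context {R : realType}.
Implicit Types t : R.

(* On [-1, 1] the iterates of this odd cubic converge pointwise to the sign
   function and stay bounded by 1. *)
Definition sign_step t := t * (3 - t ^+ 2) / 2.

Definition sign_iter k t := iter k sign_step t.

Lemma sign_iterN k t : sign_iter k (- t) = - sign_iter k t.
Proof.
elim: k => //= k; rewrite /sign_iter => ->.
by rewrite /sign_step sqrrN mulNr mulNr.
Qed.

Lemma sign_iter0 k : sign_iter k 0 = 0.
Proof. by elim: k => //= k; rewrite /sign_iter => ->; rewrite /sign_step !mul0r. Qed.

(** With [s u] for [sign_step u], one has [1 - s u = (1 - u) ^ 2 * (2 + u) / 2], so values stay at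
    most [1], and [1 - s u = (1 - (u + u ^ 2) / 2) * (1 - u)], where the first factor is at most
    [1 - t / 2] once [u >= t]. *)
Lemma sign_iter_gt0 k t : 0 < t <= 1 ->
  t <= sign_iter k t <= 1 /\ 1 - sign_iter k t <= (1 - t / 2) ^+ k.
Proof.
move=> /andP[t0 t1]; elim: k => [|k [/andP[IH1 IH2] IH3]].
  by rewrite expr0 /sign_iter /= lexx t1; split=> //; lra.
rewrite /sign_iter iterS -/(sign_iter k t).
move: (sign_iter k t) IH1 IH2 IH3 => u tu u1 IH3; rewrite /sign_step; split.
  apply/andP; split; first by nra.
  have : 0 <= (1 - u) ^+ 2 * (2 + u).
    by rewrite mulr_ge0 ?sqr_ge0//; lra.
  by rewrite expr2 => H; nra.
rewrite [leRHS]exprS; apply: (@le_trans _ _ ((1 - t / 2) * (1 - u))); last first.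
  by rewrite ler_wpM2l//; lra.
have -> : 1 - u * (3 - u ^+ 2) / 2 = (1 - (u + u ^+ 2) / 2) * (1 - u) by field.
by rewrite ler_wpM2r//; [lra|have := sqr_ge0 u; lra].
Qed.

Lemma sign_iter_le1 k t : `|t| <= 1 -> `|sign_iter k t| <= 1.
Proof.
have pos u : 0 < u -> `|u| <= 1 -> `|sign_iter k u| <= 1.
  move=> u0; rewrite gtr0_norm// => u1.
  have [|/andP[a b] _] := @sign_iter_gt0 k u; first by rewrite u0.
  by rewrite ger0_norm// (le_trans (ltW u0)).
have [t0|t0|->] := ltgtP t 0; last by rewrite sign_iter0 normr0.
  by rewrite -normrN -[`|sign_iter _ _|]normrN -sign_iterN; apply: pos; rewrite oppr_gt0.
exact: pos.
Qed.

Lemma cvg_sign_iter t : `|t| <= 1 -> sign_iter ^~ t @ \oo --> Num.sg t.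
Proof.
have pos u : 0 < u -> `|u| <= 1 -> sign_iter ^~ u @ \oo --> (1 : R).
  move=> u0; rewrite gtr0_norm// => u1.
  apply: (@squeeze_cvgr _ _ _ _ (fun k => 1 - (1 - u / 2) ^+ k) (cst 1)).
  - apply: nearW => k /=.
    have [|/andP[_ ->] H] := @sign_iter_gt0 k u; first by rewrite u0.
    by rewrite andbT; lra.
  - rewrite -[X in _ --> X]subr0; apply: cvgB; first exact: cvg_cst.
    by apply: cvg_expr; rewrite ger0_norm; lra.
  - exact: cvg_cst.
move=> t1; have [t0|t0|->] := ltgtP t 0.
- rewrite ltr0_sg//.
  have -> : sign_iter ^~ t = (fun k => - sign_iter k (- t)).
    by apply/funext => k; rewrite sign_iterN opprK.
  by apply: cvgN; apply: pos; rewrite ?normrN// oppr_gt0.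
- by rewrite gtr0_sg//; exact: pos.
- by under eq_fun do rewrite sign_iter0; rewrite sgr0; exact: cvg_cst.
Qed.

End sign_iterates.

(** * Trigonometric polynomials as an algebra *)

Section trigonometric.
Context {R : realType} {n : nat}.
Implicit Types (x l v : 'rV[R]_n).

Lemma innerDl l v x : inner (l + v) x = inner l x + inner v x.
Proof. by rewrite -big_split; apply: eq_bigr => i _; rewrite mxE mulrDl. Qed.

Lemma innerZl a v x : inner (a *: v) x = a * inner v x.
Proof. by rewrite /inner mulr_sumr; apply: eq_bigr => i _; rewrite mxE mulrA. Qed.

Lemma inner0l x : inner 0 x = 0.
Proof. by apply: big1 => i _; rewrite mxE mul0r. Qed.

Lemma innerNl v x : inner (- v) x = - inner v x.
Proof. by rewrite -scaleN1r innerZl mulN1r. Qed.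

Lemma inner_delta (i : 'I_n) x : inner (delta_mx 0 i) x = x 0 i.
Proof.
rewrite /inner (bigD1 i)//= big1 ?addr0 ?mxE ?eqxx ?mul1r// => j ji.
by rewrite mxE (negbTE ji) andbF mul0r.
Qed.

Lemma expiE l x : expi l x = cis (inner l x).
Proof. by []. Qed.

Lemma expiD l v x : expi (l + v) x = expi l x * expi v x.
Proof. by rewrite !expiE innerDl cisD. Qed.

Lemma expi0 x : expi 0 x = 1.
Proof. by rewrite expiE inner0l cis0. Qed.

Lemma normc_expi l x : normc (expi l x) = 1.
Proof. by rewrite expiE normc_cis. Qed.

(** The span of all exponentials, given inductively so that closure under products, boundedness and
    measurability follow by induction on the construction. *)
Inductive trig_poly : ('rV[R]_n -> R[i]) -> Prop :=
| trig_expi l : trig_poly (expi l)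
| trig_add f g : trig_poly f -> trig_poly g -> trig_poly (fun x => f x + g x)
| trig_scale c f : trig_poly f -> trig_poly (fun x => c * f x).

Lemma trig_cst c : trig_poly (fun=> c).
Proof.
have := trig_scale c (trig_expi 0); congr trig_poly.
by apply/funext => x; rewrite expi0 mulr1.
Qed.

Lemma trig_mul f g : trig_poly f -> trig_poly g -> trig_poly (fun x => f x * g x).
Proof.
move=> tf; elim: tf g => [l g tg|f1 f2 _ IH1 _ IH2 g tg|c f1 _ IH g tg]; first last.
- have := trig_scale c (IH _ tg); congr trig_poly.
  by apply/funext => x; rewrite mulrA.
- have := trig_add (IH1 _ tg) (IH2 _ tg); congr trig_poly.
  by apply/funext => x; rewrite mulrDl.
- elim: tg => [v|f1 f2 _ IH1 _ IH2|c f1 _ IH].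
  + have := trig_expi (l + v); congr trig_poly.
    by apply/funext => x; rewrite expiD.
  + have := trig_add IH1 IH2; congr trig_poly.
    by apply/funext => x; rewrite mulrDr.
  + have := trig_scale c IH; congr trig_poly.
    by apply/funext => x; rewrite mulrCA.
Qed.

Lemma trig_bounded f : trig_poly f -> exists2 B, 0 < B & forall x, normc (f x) <= B.
Proof.
elim=> [l|{}f g _ [B B0 fB] _ [D D0 gD]|c {}f _ [B B0 fB]].
- by exists 1 => // x; rewrite normc_expi.
- exists (B + D) => [|x]; first exact: addr_gt0.
  by apply: le_trans (normcD _ _) _; exact: lerD.
- exists (normc c * B + 1) => [|x].
    by rewrite ltr_wpDl// mulr_ge0 ?normc_ge0// ltW.
  rewrite ComplexField.Normc.normcM ler_wpDr// ler_wpM2l//.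
  exact: normc_ge0.
Qed.

Definition real_trig (f : 'rV[R]_n -> R) := trig_poly (fun x => (f x)%:C%C).

Lemma real_trig_cst a : real_trig (fun=> a).
Proof. exact: trig_cst. Qed.

Lemma real_trigD f g : real_trig f -> real_trig g -> real_trig (fun x => f x + g x).
Proof.
move=> tf tg; have := trig_add tf tg; congr trig_poly.
by apply/funext => x; rewrite rmorphD.
Qed.

Lemma real_trigM f g : real_trig f -> real_trig g -> real_trig (fun x => f x * g x).
Proof.
move=> tf tg; have := trig_mul tf tg; congr trig_poly.
by apply/funext => x; rewrite rmorphM.
Qed.

Lemma real_trig_sin l : real_trig (fun x => sin (inner l x)).
Proof.
(* The sine is the difference of two conjugate exponentials over [2i], and [- i / 2 = 1 / (2i)]. *)
have := trig_scale (- ('i / 2))%C (trig_add (trig_expi l)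
          (trig_scale (-1) (trig_expi (- l)))).
congr trig_poly; apply/funext => x.
rewrite !expiE innerNl /cis cosN sinN; move: (cos _) (sin _) => a b.
have two : (2 : R[i]) != 0 by rewrite pnatr_eq0.
apply: (mulfI two); rewrite mulrA mulrN mulrCA mulfV// mulr1.
by apply/eqP; rewrite eq_complex /=; apply/andP; split; apply/eqP; ring.
Qed.

Lemma real_trig_sign_iter k f : real_trig f -> real_trig (fun x => sign_iter k (f x)).
Proof.
move=> tf; elim: k => // k IH; rewrite /sign_iter /= /sign_step.
have -> : (fun x => iter k sign_step (f x) * (3 - (iter k sign_step (f x)) ^+ 2) / 2) =
    (fun x => (2^-1 * sign_iter k (f x)) *
              (3 + -1 * (sign_iter k (f x) * sign_iter k (f x)))).
  by apply/funext => x; rewrite /sign_iter expr2; field.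
apply: real_trigM; first by apply: real_trigM => //; exact: real_trig_cst.
apply: real_trigD; first exact: real_trig_cst.
by apply: real_trigM; [exact: real_trig_cst|exact: real_trigM].
Qed.

End trigonometric.

(** * Limits of trigonometric polynomials generate the Borel sets *)

Section borel_generation.
Context {R : realType} {n : nat}.
Implicit Types (x l v : 'rV[R]_n) (A : set 'rV[R]_n).

Lemma continuous_borelRn (f : 'rV[R]_n -> R) : continuous f ->
  measurable_fun setT (f : borelRn R n -> R).
Proof.
move=> cf; apply: (measurability (@RGenOInfty.G R)).
  exact: RGenOInfty.measurableE.
move=> _ [_ [a ->] <-]; rewrite setTI; apply: sub_sigma_algebra.
by move/continuousP: cf; apply; exact: rray_open.
Qed.

Lemma measurable_coord (i : 'I_n) :
  measurable_fun setT ((fun x => x 0 i) : borelRn R n -> R).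
Proof. by apply: continuous_borelRn; exact: coord_continuous. Qed.

Lemma measurable_inner l : measurable_fun setT (inner l : borelRn R n -> R).
Proof.
apply: measurable_sum => i; apply: measurable_funM; first exact: measurable_cst.
exact: measurable_coord.
Qed.

Lemma measurable_enorm : measurable_fun setT (@enorm R n : borelRn R n -> R).
Proof.
have -> : @enorm R n = fun x => inner x x `^ 2^-1.
  apply/funext => x; rewrite powR12_sqrt// /inner sumr_ge0// => i _.
  by rewrite -expr2 sqr_ge0.
apply: (@measurableT_comp _ _ _ _ _ _ (@powR R ^~ 2^-1)) => //.
by apply: measurable_sum => i; apply: measurable_funM; exact: measurable_coord.
Qed.

Lemma cmeasurable_expi l : cmeasurable (expi l : borelRn R n -> R[i]).
Proof.
split; apply: (measurableT_comp _ (measurable_inner l)).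
  by apply: continuous_measurable_fun => x; exact: continuous_cos.
by apply: continuous_measurable_fun => x; exact: continuous_sin.
Qed.

Lemma cmeasurable_trig (f : 'rV[R]_n -> R[i]) : trig_poly f ->
  cmeasurable (f : borelRn R n -> R[i]).
Proof.
elim=> [l|{}f g _ mf _ mg|c {}f _ mf]; first exact: cmeasurable_expi.
  exact: cmeasurableD.
exact: (cmeasurableM (cmeasurable_cst c) mf).
Qed.

Lemma measurable_real_trig (f : 'rV[R]_n -> R) : real_trig f ->
  measurable_fun setT (f : borelRn R n -> R).
Proof. by move=> /cmeasurable_trig[]. Qed.

(* The balls of the sup norm with rational centers form a countable basis. *)
Lemma open_measurable_coord (G : set (set 'rV[R]_n)) :
  (forall i : 'I_n, measurable_fun setT ((fun x => x 0 i) : g_sigma_algebraType G -> R)) ->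
  forall O : set 'rV[R]_n, open O -> <<s G >> O.
Proof.
move=> mcoord O oO.
pose q (u : 'I_n -> rat) : 'rV[R]_n := \row_i ratr (u i).
(* Centers are finite functions because these form a countable type, which the union over all
   centers and radii requires. *)
pose B (u : {ffun 'I_n -> rat}) (k : nat) : set 'rV[R]_n :=
  [set x | forall i, `|ratr (u i) - x 0 i| < k.+1%:R^-1].
have mB u k : <<s G >> (B u k).
  have -> : B u k = \bigcap_(i in [set: 'I_n])
      ((fun x : g_sigma_algebraType G => x 0 i) @^-1` ball (ratr (u i) : R) k.+1%:R^-1).
    by apply/seteqP; split=> x /= H i; [move=> _|]; exact: H.
  apply: (@fin_bigcap_measurable _ (g_sigma_algebraType G)) => // i _.
  rewrite -[X in measurable X]setTI; apply: mcoord => //.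
  exact: measurable_ball.
(* Cubes not contained in [O] are replaced by the empty set, so that the index set is the whole
   countable type. *)
have -> : O = \bigcup_(uk in [set: {ffun 'I_n -> rat} * nat])
    (if `[< B uk.1 uk.2 `<=` O >] then B uk.1 uk.2 else set0).
  apply/seteqP; split=> [x Ox|x [[u k] _]]; last first.
    by case: asboolP => // BO; exact: BO.
  have /nbhs_ballP[e /= e0 eO] := open_nbhs_nbhs (conj oO Ox).
  (* Both [x] and any other point of the cube lie within [1 / (k + 1)] of the center, whence the
     [2]. *)
  have [k ke] : exists k, 2 / k.+1%:R <= e.
    exists (Num.bound (2 / e)); rewrite ler_pdivrMr ?ltr0n//.
    have : 2 / e < (Num.bound (2 / e))%:R by apply: archi_boundP; rewrite divr_ge0 ?ltW.
    rewrite ltr_pdivrMr// mulrC => /ltW/le_trans; apply.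
    by rewrite ler_pM2l// ler_nat.
  have k0 : (0 : R) < k.+1%:R^-1 by rewrite invr_gt0 ltr0n.
  have uex (i : 'I_n) : exists u : rat, `|ratr u - x 0 i| < k.+1%:R^-1.
    move: k.+1%:R^-1 k0 => c c0.
    have [|u] := @rat_in_itvoo R (x 0 i - c) (x 0 i + c); first by lra.
    rewrite in_itv/= => /andP[u1 u2].
    by exists u; rewrite ltr_norml; apply/andP; split; lra.
  have [u uP] := choice uex.
  exists ([ffun i => u i], k) => //=.
  have xB : B [ffun i => u i] k x by move=> i; rewrite ffunE.
  suff BO : B [ffun i => u i] k `<=` O by rewrite asboolT.
  move=> y yB; apply: eO; split=> // i j.
  rewrite (ord1 i) /ball /=; have := xB j; have := yB j; rewrite !ffunE => h1 h2.
  rewrite -[x 0 j](subrK (ratr (u j))) -addrA.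
  apply: le_lt_trans (ler_normD _ _) _; rewrite distrC.
  by apply: lt_le_trans ke; rewrite -[2]/(1 + 1) mulrDl mul1r; exact: ltrD.
apply: (@countable_bigcupT_measurable _ (g_sigma_algebraType G)) => [|[u k]] /=.
  exact: countableP.
by case: asboolP => _; [exact: mB|exact: measurable0].
Qed.

(* The multiplicative structure of [real_trig] makes this a pi-system. *)
Definition trig_limit_set : set (set 'rV[R]_n) := [set A | exists fk : nat -> 'rV[R]_n -> R,
  [/\ forall k, real_trig (fk k), forall k x, `|fk k x| <= 1 &
      forall x, fk ^~ x @ \oo --> (\1_A x : R)]].

Lemma trig_limit_setI : setI_closed trig_limit_set.
Proof.
move=> A B [f [tf f1 fA]] [g [tg g1 gB]].
exists (fun k x => f k x * g k x); split=> [k|k x|x].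
- exact: real_trigM.
- by rewrite normrM mulr_ile1.
- by rewrite indicI /=; apply: cvgM; [exact: fA|exact: gB].
Qed.

Lemma trig_limit_set_measurable A : trig_limit_set A ->
  measurable (A : set (borelRn R n)).
Proof.
move=> [f [tf _ fA]]; apply/(measurable_indicP R).
apply: (@measurable_fun_cvg _ _ _ _ (f : nat -> borelRn R n -> R)).
  by move=> k; exact: measurable_real_trig.
by move=> x _; exact: fA.
Qed.

(** Dividing [f] by a bound puts its values in [[-1, 1]], where polynomial iterates converge to the
    sign of [f]. *)
Lemma trig_limit_set_gt0 (f : 'rV[R]_n -> R) : real_trig f ->
  trig_limit_set [set x | 0 < f x].
Proof.
move=> tf; have [B B0 fB] := trig_bounded tf.
pose g x := B^-1 * f x.
have tg : real_trig g by apply: real_trigM => //; exact: real_trig_cst.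
have g1 x : `|g x| <= 1.
  rewrite /g normrM gtr0_norm ?invr_gt0// ler_pdivrMl// mulr1.
  by have := fB x; rewrite normcR.
pose s k x := sign_iter k (g x).
have s1 k x : `|s k x| <= 1 by exact: sign_iter_le1.
(* The polynomial [(s + s ^ 2) / 2] sends the signs [-1], [0], [1] to [0], [0], [1], and maps
   [[-1, 1]] into itself. *)
exists (fun k x => 2^-1 * (s k x + s k x * s k x)); split=> [k|k x|x].
- apply: real_trigM; first exact: real_trig_cst.
  have ts : real_trig (s k) by exact: real_trig_sign_iter.
  by apply: real_trigD => //; exact: real_trigM.
- have := s1 k x; rewrite !ler_norml => /andP[a b].
  by apply/andP; split; nra.
- have -> : \1_[set x | 0 < f x] x = 2^-1 * (Num.sg (g x) + Num.sg (g x) * Num.sg (g x)) :> R.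
    have -> : \1_[set x | 0 < f x] x = (0 < f x)%R%:R :> R.
      by rewrite indicE; congr ((nat_of_bool _)%:R); apply/idP/idP; rewrite inE.
    rewrite /g sgrM gtr0_sg ?invr_gt0// mul1r.
    have [f0|f0|<-] := ltgtP 0 (f x).
    + by rewrite gtr0_sg//=; field.
    + by rewrite ltr0_sg//=; field.
    + by rewrite sgr0 /=; field.
  have := cvg_sign_iter (g1 x) => sx.
  by apply: cvgM; [exact: cvg_cst|apply: cvgD => //; exact: cvgM].
Qed.

Lemma measurable_trig_limit (f : 'rV[R]_n -> R) : real_trig f ->
  measurable_fun setT (f : g_sigma_algebraType trig_limit_set -> R).
Proof.
move=> tf; apply: (measurability (@RGenOInfty.G R)).
  exact: RGenOInfty.measurableE.
move=> _ [_ [a ->] <-]; rewrite setTI; apply: sub_sigma_algebra.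
have -> : f @^-1` `]a, +oo[%classic = [set x | 0 < f x + (- a)].
  by apply/seteqP; split=> x /=; rewrite in_itv/= andbT subr_gt0.
by apply/trig_limit_set_gt0/real_trigD => //; exact: real_trig_cst.
Qed.

(** A coordinate is unbounded, hence no bounded limit of trigonometric polynomials, but it is the
    pointwise limit of [(k + 1) sin (x_i / (k + 1))]. *)
Lemma measurable_coord_trig_limit (i : 'I_n) :
  measurable_fun setT ((fun x => x 0 i) : g_sigma_algebraType trig_limit_set -> R).
Proof.
pose f (k : nat) (x : 'rV[R]_n) : R :=
  k.+1%:R * sin (inner (k.+1%:R^-1 *: delta_mx 0 i) x).
apply: (@measurable_fun_cvg _ _ _ _ (f : nat -> g_sigma_algebraType _ -> R)).
  move=> k; apply: measurable_trig_limit; apply: real_trigM.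
    exact: real_trig_cst.
  exact: real_trig_sin.
move=> x _; apply/cvgrPdist_le => e e0.
set y := x 0 i; near=> k.
have k0 : (0 : R) < k.+1%:R by rewrite ltr0n.
rewrite /f innerZl inner_delta -/y.
have -> : y - k.+1%:R * sin (k.+1%:R^-1 * y) =
    - (k.+1%:R * (sin (k.+1%:R^-1 * y) - k.+1%:R^-1 * y)).
  by field; rewrite gt_eqF.
rewrite normrN normrM gtr0_norm//.
(* The second-order remainder, multiplied by [k + 1], leaves an error of at most
   [y ^ 2 / (k + 1)]. *)
have [_] := cos_sin_taylor 2 (k.+1%:R^-1 * y).
have -> : (sinT 2).[k.+1%:R^-1 * y] = k.+1%:R^-1 * y.
  rewrite /sinT horner_poly !big_ord_recl big_ord0 /=.
  by rewrite mul0r mul0r add0r addr0 divr1 mul1r.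
move=> /(ler_wpM2l (ltW k0)) /le_trans; apply.
have -> : k.+1%:R * `|k.+1%:R^-1 * y| ^+ 2 = `|y| ^+ 2 / k.+1%:R.
  by rewrite normrM gtr0_norm ?invr_gt0//; field; rewrite gt_eqF.
rewrite ler_pdivrMr// mulrC -ler_pdivrMr//.
apply: (@le_trans _ _ k%:R); last by rewrite ler_nat.
near: k; exact: nbhs_infty_ger.
Unshelve. all: by end_near. Qed.

(** Measurable coordinates put the open sets into the generated sigma-algebra; conversely the sets
    of the pi-system have indicators that are limits of continuous functions. *)
Lemma borelRnE : (@measurable _ (borelRn R n)) = <<s trig_limit_set >>.
Proof.
apply/seteqP; split.
  apply: smallest_sub; first exact: smallest_sigma_algebra.
  exact: (open_measurable_coord measurable_coord_trig_limit).
apply: smallest_sub; first exact: sigma_algebra_measurable.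
exact: trig_limit_set_measurable.
Qed.

End borel_generation.

(** * Totality of the exponentials for a finite measure *)

Section exponentials_total.
Context {R : realType} {n : nat}.
Variables (mu : {measure set (borelRn R n) -> \bar R}) (p : R).
Variable F : set ('rV[R]_n -> R[i]).
Hypothesis p1 : 1 <= p.
Hypothesis mu_fin : (mu setT < +oo)%E.
Hypothesis F0 : F (fun=> 0).
Hypothesis FD : forall f g, F f -> F g -> F (fun x => f x + g x).
Hypothesis FZ : forall c f, F f -> F (fun x => c * f x).
Hypothesis Fm : forall f, F f -> cmeasurable (f : borelRn R n -> R[i]).
Local Notation cl := (@Lp_closure _ (borelRn R n) R mu p F).
Hypothesis F_expi : forall l, cl (expi l).

Let clD := @Lp_closureD _ (borelRn R n) R mu _ p1 _ FD Fm.
Let clZ := @Lp_closureZ _ (borelRn R n) R mu _ p1 _ F0 FZ Fm.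
Let clB := @Lp_closureB _ (borelRn R n) R mu _ p1 _ F0 FD FZ Fm.

Lemma cLnorm_cst_lty (c : R) :
  (cLnorm mu p (fun _ : borelRn R n => c%:C%C) < +oo)%E.
Proof.
apply: cLnorm_lty => //; rewrite /Lp_integral integral_cst//.
by rewrite lte_mul_pinfty// ?lee_fin ?powR_ge0.
Qed.

Let cl_trig f : trig_poly f -> cl f.
Proof. by elim=> [l|{}f g _ mf _ mg|c {}f _ mf]; [exact: F_expi|exact: clD|exact: clZ]. Qed.

(** For a finite measure the constant [2] is a dominating function in [L_p]. *)
Let cl_bounded_lim (fk : nat -> 'rV[R]_n -> R) (f : 'rV[R]_n -> R) :
  (forall k, cl (fun x => (fk k x)%:C%C)) ->
  measurable_fun setT (f : borelRn R n -> R) ->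
  (forall k x, `|fk k x - f x| <= 2) ->
  (forall x, fk ^~ x @ \oo --> f x) -> cl (fun x => (f x)%:C%C).
Proof.
move=> clfk mf bnd lim.
apply: (@Lp_closure_dominated _ (borelRn R n) R mu _ p1 _ Fm
  (fun k x => (fk k x)%:C%C) _ (cst 2)) => //.
- exact: cLnorm_cst_lty.
- by move=> k x; rewrite -rmorphB normcR.
- move=> x; under eq_fun do rewrite -rmorphB normcR.
  apply/norm_cvg0P.
  by rewrite -(subrr (f x)); apply: cvgB; [exact: lim|exact: cvg_cst].
Qed.

Let indic01 (A : set 'rV[R]_n) x : 0 <= (\1_A x : R) <= 1.
Proof. by rewrite indicE; case: (_ \in _); rewrite ?lexx ler01. Qed.

(** Dynkin's theorem: the measurable sets whose indicator lies in the closure contain the pi-system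
    and are stable under complements and countable disjoint unions. *)
Lemma Lp_closure_indic A : measurable (A : set (borelRn R n)) ->
  cl (fun x => (\1_A x)%:C%C).
Proof.
move=> mA; have sA : <<s (@trig_limit_set R n) >> A by rewrite -borelRnE.
pose P : set_system (borelRn R n) := fun A => cl (fun x => (\1_A x)%:C%C).
apply: (@dynkin_induction _ (borelRn R n) (@trig_limit_set R n) P _ _ _ _ _ _ A) => //.
- exact: borelRnE.
- exact: trig_limit_setI.
- have := cl_trig (trig_cst 1); congr (Lp_closure _ _ _).
  by apply/funext => x; rewrite indicT.
- move=> B CB; have mB := trig_limit_set_measurable CB.
  have [f [tf f1 fB]] := CB; apply: (cl_bounded_lim (fk := f)) => //.
  + by move=> k; have := cl_trig (tf k).
  + move=> k x; apply: le_trans (ler_normB _ _) _.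
    rewrite -[2]/(1 + 1); apply: lerD => //.
    by have /andP[a b] := indic01 B x; rewrite ger0_norm.
- move=> B mB PB; have := clB (cl_trig (trig_cst 1)) PB.
  congr (Lp_closure _ _ _); apply/funext => x; rewrite -rmorphB; congr (_%:C%C).
  by rewrite !indicE in_setC; case: (_ \in _); rewrite /= ?subrr ?subr0.
- move=> B mB tB PB.
  (* Disjointness makes the partial sums indicators again, hence bounded by [1] uniformly in [k]. *)
  have sumE k x : \sum_(i < k) (\1_(B i) x : R) = \1_(\big[setU/set0]_(i < k) B i) x.
    elim: k => [|k IH]; first by rewrite !big_ord0 indic0.
    rewrite !big_ord_recr /= IH !indicE in_setU.
    case: (boolP (x \in B k)) => xk; last by rewrite orbF addr0.
    rewrite orbT (_ : (_ \in _) = false) ?add0r//.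
    apply/negbTE/negP; rewrite inE -bigcup_mkord => -[i /= ik xi].
    have /eqP := tB i k I I (ex_intro _ x (conj xi (set_mem xk))).
    by rewrite ltn_eqF.
  apply: (cl_bounded_lim (fk := fun k x => \sum_(i < k) \1_(B i) x)).
  + move=> k.
    have := @Lp_closure_sum _ (borelRn R n) R mu _ p1 _ F0 FD Fm k
      (fun i x => (\1_(B i) x)%:C%C) (fun i => PB i).
    by congr (Lp_closure _ _ _); apply/funext => x; rewrite rmorph_sum.
  + by apply: measurable_indic; exact: bigcupT_measurable.
  + move=> k x; rewrite sumE.
    have /andP[a b] := indic01 (\bigcup_k B k) x.
    have /andP[c e] := indic01 (\big[setU/set0]_(i < k) B i) x.
    by rewrite ler_norml; apply/andP; split; lra.
  + move=> x; under eq_fun do rewrite sumE.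
    apply: cvg_near_cst.
    have [[i _ xi]|xn] := pselect ((\bigcup_k B k) x).
      exists i.+1 => // k /= ik; rewrite !indicE.
      rewrite !mem_set//; first by exists i.
      by rewrite -bigcup_mkord; exists i.
    apply: nearW => k; rewrite !indicE !memNset// -bigcup_mkord.
    by move=> [i /= _ xi]; apply: xn; exists i.
Qed.

Lemma Lp_closure_of_expi f : inLp mu p f -> cl f.
Proof. exact: (@Lp_closure_full _ (borelRn R n) R mu p F p1 F0 FD FZ Fm Lp_closure_indic). Qed.

End exponentials_total.

(** * Polynomial growth and quasi-analyticity *)

Section polynomial_growth.
Context {R : realType} {n : nat}.
Implicit Types (x l v : 'rV[R]_n) (f g : 'rV[R]_n -> R[i]).

Lemma inner_ge0 x : 0 <= inner x x.
Proof. by rewrite sumr_ge0// => i _; rewrite -expr2 sqr_ge0. Qed.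

Lemma enorm_ge0 x : 0 <= enorm x.
Proof. exact: sqrtr_ge0. Qed.

Lemma coord_le_enorm x i : `|x 0 i| <= enorm x.
Proof.
rewrite -sqrtr_sqr ler_wsqrtr// expr2 /inner (bigD1 i)//= lerDl sumr_ge0// => j _.
by rewrite -expr2 sqr_ge0.
Qed.

(** Bounding the inner product by this norm times [enorm x] needs only the coordinatewise estimate;
    the constant is irrelevant to the divergence condition. *)
Definition l1norm v : R := \sum_(i < n) `|v 0 i|.

Lemma l1norm_ge0 v : 0 <= l1norm v.
Proof. exact: sumr_ge0. Qed.

Lemma inner_le v x : `|inner v x| <= l1norm v * enorm x.
Proof.
apply: le_trans (ler_norm_sum _ _ _) _; rewrite mulr_suml.
by apply: ler_sum => i _; rewrite normrM ler_wpM2l// coord_le_enorm.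
Qed.

Definition poly_growth f := cmeasurable (f : borelRn R n -> R[i]) /\
  exists c k, forall x, normc (f x) <= c * (1 + enorm x) ^+ k.

Let growth_ge0 f c k : (forall x, normc (f x) <= c * (1 + enorm x) ^+ k) -> 0 <= c.
Proof.
move=> /(_ 0) /(le_trans (normc_ge0 _)).
by rewrite pmulr_lge0// exprn_gt0// ltr_pwDl// enorm_ge0.
Qed.

Lemma poly_growth_cst c : poly_growth (fun=> c).
Proof.
split; first exact: cmeasurable_cst.
by exists (normc c), 0%N => x; rewrite expr0 mulr1.
Qed.

Lemma poly_growth_coord i : poly_growth (fun x => (x 0 i)%:C%C).
Proof.
split; first by apply: cmeasurableR; exact: measurable_coord.
exists 1, 1%N => x; rewrite normcR mul1r expr1.
by apply: le_trans (coord_le_enorm _ _) _; rewrite lerDr.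
Qed.

Lemma poly_growthM f g : poly_growth f -> poly_growth g ->
  poly_growth (fun x => f x * g x).
Proof.
move=> [mf [c [k fb]]] [mg [e [j gb]]]; split; first exact: cmeasurableM.
exists (c * e), (k + j)%N => x; rewrite ComplexField.Normc.normcM exprD mulrACA.
by apply: ler_pM => //; exact: normc_ge0.
Qed.

Lemma poly_growthD f g : poly_growth f -> poly_growth g ->
  poly_growth (fun x => f x + g x).
Proof.
move=> [mf [c [k fb]]] [mg [e [j gb]]]; split; first exact: cmeasurableD.
have c0 := growth_ge0 fb; have e0 := growth_ge0 gb.
have s1 x : 1 <= 1 + enorm x by rewrite lerDl enorm_ge0.
exists (c + e), (k + j)%N => x; apply: le_trans (normcD _ _) _.
rewrite mulrDl; apply: lerD.
  by apply: le_trans (fb x) _; rewrite ler_wpM2l// ler_weXn2l// leq_addr.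
by apply: le_trans (gb x) _; rewrite ler_wpM2l// ler_weXn2l// leq_addl.
Qed.

Lemma poly_growth_polyfun (P : mpoly.mpoly n R[i]) : poly_growth (polyfun P).
Proof.
have -> : polyfun P = fun x => \sum_(m <- mpoly.msupp P)
   mpoly.mcoeff m P * \prod_i (x 0 i)%:C%C ^+ mpoly.fun_of_multinom m i.
  by apply/funext => x; rewrite /polyfun mpoly.mevalE.
elim: (mpoly.msupp P) => [|m s IH].
  by under eq_fun do rewrite big_nil; exact: poly_growth_cst.
under eq_fun do rewrite big_cons; apply: poly_growthD IH.
apply: poly_growthM; first exact: poly_growth_cst.
elim: (index_enum _) => [|i {}s IH].
  by under eq_fun do rewrite big_nil; exact: poly_growth_cst.
under eq_fun do rewrite big_cons; apply: poly_growthM IH.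
elim: (mpoly.fun_of_multinom m i) => [|k IH].
  by under eq_fun do rewrite expr0; exact: poly_growth_cst.
under eq_fun do rewrite exprS; apply: poly_growthM IH.
exact: poly_growth_coord.
Qed.

Lemma polyfun_cst c : range (@polyfun R n) (fun=> c).
Proof.
exists (mpoly.mpolyC n c) => //; apply/funext => x.
by rewrite /polyfun mpoly.mevalC.
Qed.

Lemma polyfunD f g : range (@polyfun R n) f -> range (@polyfun R n) g ->
  range (@polyfun R n) (fun x => f x + g x).
Proof.
move=> [P _ <-] [Q _ <-]; exists (P + Q) => //; apply/funext => x.
by rewrite /polyfun mpoly.mevalD.
Qed.

Lemma polyfunM f g : range (@polyfun R n) f -> range (@polyfun R n) g ->
  range (@polyfun R n) (fun x => f x * g x).
Proof.
move=> [P _ <-] [Q _ <-]; exists (P * Q) => //; apply/funext => x.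
by rewrite /polyfun mpoly.mevalM.
Qed.

Lemma polyfunZ c f : range (@polyfun R n) f ->
  range (@polyfun R n) (fun x => c * f x).
Proof. exact: (polyfunM (polyfun_cst c)). Qed.

Lemma polyfun_innerX v j : range (@polyfun R n) (fun x => (inner v x ^+ j)%:C%C).
Proof.
elim: j => [|j IH].
  by under [X in range _ X]eq_fun do rewrite expr0; exact: polyfun_cst.
under [X in range _ X]eq_fun do rewrite exprS rmorphM; apply: polyfunM IH.
rewrite /inner; elim: (index_enum _) => [|i s IH].
  by under [X in range _ X]eq_fun do rewrite big_nil; exact: polyfun_cst.
under [X in range _ X]eq_fun do rewrite big_cons rmorphD rmorphM.
apply: polyfunD IH; apply: polyfunZ.
exists (mpoly.mpolyX R[i] (mpoly.mnm1 i)) => //; apply/funext => x.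
by rewrite /polyfun mpoly.mevalXU.
Qed.

Lemma cmeasurable_innerX v j :
  cmeasurable ((fun x => (inner v x ^+ j)%:C%C) : borelRn R n -> R[i]).
Proof. by apply: cmeasurableR; apply: measurable_funX; exact: measurable_inner. Qed.

End polynomial_growth.

(** * Consequences of the Carleman condition on the moments *)

Section moment_growth.
Context {R : realType} {n : nat}.
Variables (mu : {measure set (borelRn R n) -> \bar R}) (p : R).
Hypothesis p1 : 1 <= p.
Variables (C : R) (m : nat -> R).
Hypothesis C0 : 0 < C.
Hypothesis m_gt0 : forall k, 0 < m k.
Hypothesis m_mono : forall k l, (k <= l)%N -> m k <= m l.
Hypothesis m_div : forall B : R, exists N, B <= \sum_(k < N) (m k)^-1.
Hypothesis moments : forall j, (cLnorm mu p
  (fun x : borelRn R n => (enorm x ^+ j)%:C%C) <= (C * \prod_(k < j) m k)%:E)%E.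

Let M j := C * \prod_(k < j) m k.

Let cmeasurable_enormX j :
  cmeasurable ((fun x => (enorm x ^+ j)%:C%C) : borelRn R n -> R[i]).
Proof. by apply: cmeasurableR; apply: measurable_funX; exact: measurable_enorm. Qed.

Lemma cLnorm_enorm_bound (f : borelRn R n -> R[i]) c j : cmeasurable f -> 0 <= c ->
  (forall x, normc (f x) <= c * enorm x ^+ j) -> (cLnorm mu p f <= (c * M j)%:E)%E.
Proof.
move=> mf c0 fc; apply: le_trans (cLnorm_mono mu p1 mf _ fc) _.
  apply: measurable_funM; first exact: measurable_cst.
  by apply: measurable_funX; exact: measurable_enorm.
have -> : (fun x : borelRn R n => (c * enorm x ^+ j)%:C%C) =
    (fun x => c%:C%C * (enorm x ^+ j)%:C%C) by apply/funext => x; rewrite rmorphM.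
by rewrite cLnormZ// normcR ger0_norm// EFinM lee_wpmul2l.
Qed.

Lemma growth_finite_measure : (mu setT < +oo)%E.
Proof.
have := moments 0; under eq_fun do rewrite expr0.
move=> /le_lt_trans/(_ (ltry _))/(Lp_integral_lty p1).
rewrite /Lp_integral; under eq_integral do rewrite normcR normr1 powR1.
by rewrite integral_cst// mul1e.
Qed.

Lemma poly_growth_inLp f : poly_growth f -> inLp mu p (f : borelRn R n -> R[i]).
Proof.
move=> [mf [c [k fb]]]; split=> //.
have c0 : 0 <= c.
  move: (fb 0) => /(le_trans (normc_ge0 _)).
  by rewrite pmulr_lge0// exprn_gt0// ltr_pwDl// enorm_ge0.
have me := @measurable_enorm R n.
(* With [s = enorm x], [1 + s] is at most [2] when [s <= 1] and at most [2 * s] otherwise. *)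
have bnd x : normc (f x) <= c * 2 ^+ k + c * 2 ^+ k * enorm x ^+ k.
  have -> : c * 2 ^+ k + c * 2 ^+ k * enorm x ^+ k = c * (2 ^+ k * (1 + enorm x ^+ k)).
    by ring.
  apply: le_trans (fb x) _; rewrite ler_wpM2l//.
  have s0 := enorm_ge0 x; have [s1|/ltW s1] := leP (enorm x) 1.
    apply: (@le_trans _ _ (2 ^+ k)).
      by rewrite lerXn2r ?nnegrE//; lra.
    by rewrite ler_peMr ?exprn_ge0// lerDl exprn_ge0.
  apply: (@le_trans _ _ (2 ^+ k * enorm x ^+ k)).
    by rewrite -exprMn lerXn2r ?nnegrE//; lra.
  by rewrite ler_wpM2l ?exprn_ge0// lerDr.
apply: le_lt_trans (cLnorm_mono mu p1 mf _ bnd) _.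
  apply: measurable_funD; first exact: measurable_cst.
  by apply: measurable_funM; [exact: measurable_cst|exact: measurable_funX].
under eq_fun do rewrite rmorphD.
apply: le_lt_trans (cLnormD mu p1 (cmeasurable_cst _) _) _.
  by apply: cmeasurableR; apply: measurable_funM; [exact: measurable_cst|exact: measurable_funX].
apply: lte_add_pinfty; first by apply: cLnorm_cst_lty => //; exact: growth_finite_measure.
apply: le_lt_trans (ltry _).
  apply: (@cLnorm_enorm_bound _ (c * 2 ^+ k) k).
  - by apply: cmeasurableR; apply: measurable_funM; [exact: measurable_cst|exact: measurable_funX].
  - by rewrite mulr_ge0// exprn_ge0.
  - by move=> x; rewrite normcR ger0_norm// mulr_ge0 ?mulr_ge0 ?exprn_ge0 ?enorm_ge0.
Qed.

Section translation.
Variable F : set ('rV[R]_n -> R[i]).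
Hypothesis F0 : F (fun=> 0).
Hypothesis FD : forall f g, F f -> F g -> F (fun x => f x + g x).
Hypothesis FZ : forall c f, F f -> F (fun x => c * f x).
Hypothesis Fm : forall f, F f -> cmeasurable (f : borelRn R n -> R[i]).
Local Notation cl := (@Lp_closure _ (borelRn R n) R mu p F).
Local Notation dist_le := (@Lp_dist_le _ (borelRn R n) R mu p F).

(** Up to the factor [i ^ j], the function [f j t] below is the [j]-th derivative in [t] of the
    exponential with frequency [l + t v]. Bang's argument runs from [t = 0], where all distances
    vanish, to [t = 1]. *)
Lemma Lp_closure_expi_translate l v :
  (forall j, cl (fun x => (inner v x ^+ j)%:C%C * expi l x)) -> cl (expi (l + v)).
Proof.
move=> clj.
pose f j t : borelRn R n -> R[i] :=
  fun x => (inner v x ^+ j)%:C%C * expi (l + t *: v) x.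
have mf j t : cmeasurable (f j t).
  by apply: cmeasurableM; [exact: cmeasurable_innerX|exact: cmeasurable_expi].
(* The summand [1] keeps [K] positive when [v = 0]. The powers [K ^ j] are absorbed by scaling every
   [m k] by [K], which preserves monotonicity and divergence. *)
pose K := l1norm v + 1.
have K0 : 0 < K by rewrite ltr_wpDl// l1norm_ge0.
have vK x : `|inner v x| <= K * enorm x.
  apply: le_trans (inner_le _ _) _; rewrite ler_wpM2r ?enorm_ge0//.
  by rewrite lerDl.
pose m' k := K * m k.
have MK j : C * \prod_(k < j) m' k = K ^+ j * M j.
  by rewrite /m' big_split/= prodr_const card_ord mulrCA.
have Q_M j t : dist_le (f j t) (C * \prod_(k < j) m' k).
  apply: Lp_dist_norm => //; rewrite MK; apply: cLnorm_enorm_bound => //.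
    by rewrite exprn_ge0// ltW.
  move=> x; rewrite /f ComplexField.Normc.normcM normc_expi mulr1 normcR normrX.
  by rewrite -exprMn lerXn2r ?nnegrE// mulr_ge0 ?enorm_ge0// ltW.
have Q_taylor j L t h (b : nat -> R) : 0 <= h ->
    (forall i, (i < L)%N -> dist_le (f (j + i)%N t) (b i)) ->
    dist_le (f j (t + h))
      (\sum_(i < L) h ^+ i * b i + 2 * h ^+ L * (C * \prod_(k < j + L) m' k)).
  move=> h0 Hb.
  pose c (i : nat) : R[i] := 'i%C ^+ i * (h ^+ i / i`!%:R)%:C%C.
  pose P : borelRn R n -> R[i] := fun x => \sum_(i < L) c i * f (j + i)%N t x.
  have mP : cmeasurable P.
    by apply: cmeasurable_sum => i; apply: cmeasurableM => //; exact: cmeasurable_cst.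
  (* Factoring out the exponential at time [t] leaves the Taylor remainder of [cis] at
     [h * inner v x]. *)
  have fE x : f j (t + h) x - P x = (inner v x ^+ j)%:C%C * expi (l + t *: v) x *
      (cis (h * inner v x) -
        \sum_(k < L) 'i%C ^+ k * ((h * inner v x) ^+ k / k`!%:R)%:C%C).
    have -> : f j (t + h) x =
        (inner v x ^+ j)%:C%C * expi (l + t *: v) x * cis (h * inner v x).
      by rewrite /f scalerDl addrA (expiD (l + t *: v)) (expiE (h *: v)) innerZl mulrA.
    rewrite mulrBr; congr (_ - _); rewrite /P mulr_sumr; apply: eq_bigr => i _.
    rewrite /c /f exprD exprMn -[h ^+ i * _ / _]mulrAC !rmorphM /=.
    by move: (expi _ x) ('i ^+ i)%C => z w; ring.
  have -> : f j (t + h) = (fun x => P x + (f j (t + h) x - P x)).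
    by apply/funext => x; rewrite [RHS]addrCA subrr addr0.
  apply: Lp_distD => //.
  - exact: cmeasurableB.
  - apply: Lp_dist_sum => // i; first by apply: cmeasurableM => //; exact: cmeasurable_cst.
    have bi0 : 0 <= b i by apply: Lp_dist_ge0 (Hb i _).
    apply: (@Lp_dist_weak _ _ _ _ _ _ _ (normc (c i) * b i)); last first.
      by apply: Lp_distZ => //; exact: Hb.
    (* The factor [1 / i!] is discarded, as the hypothesis [Q_taylor] of Bang's lemma has none. *)
    rewrite ler_wpM2r// /c ComplexField.Normc.normcM normcX normci expr1n mul1r normcR.
    rewrite ger0_norm ?divr_ge0 ?exprn_ge0// ler_pdivrMr ?ltr0n ?fact_gt0//.
    by rewrite ler_peMr ?exprn_ge0// ler1n fact_gt0.
  - apply: Lp_dist_norm => //; rewrite MK mulrA; apply: cLnorm_enorm_bound.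
    + exact: cmeasurableB.
    + by rewrite mulr_ge0 ?mulr_ge0 ?exprn_ge0// ltW.
    + move=> x; rewrite fE !ComplexField.Normc.normcM normc_expi mulr1 normcR normrX.
      apply: (@le_trans _ _ (`|inner v x| ^+ j * (2 * `|h * inner v x| ^+ L))).
        by rewrite ler_wpM2l ?exprn_ge0// cis_taylor.
      rewrite normrM (ger0_norm h0) exprMn.
      have -> : `|inner v x| ^+ j * (2 * (h ^+ L * `|inner v x| ^+ L)) =
          2 * h ^+ L * `|inner v x| ^+ (j + L) by rewrite exprD; ring.
      rewrite -[leRHS]mulrA ler_wpM2l ?mulr_ge0 ?exprn_ge0//.
      by rewrite -exprMn lerXn2r ?nnegrE// mulr_ge0 ?enorm_ge0// ltW.
have Q0 j : dist_le (f j 0) 0.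
  by have [_] := clj j; congr (Lp_dist_le _ _ _ _); apply/funext => x;
     rewrite /f scale0r addr0.
have m'_gt0 k : 0 < m' k by exact: mulr_gt0.
have m'_mono k k' : (k <= k')%N -> m' k <= m' k'.
  by move=> kk; rewrite ler_wpM2l ?(ltW K0)// m_mono.
have m'_div (B : R) : exists N, B <= \sum_(k < N) (m' k)^-1.
  have [N hN] := m_div (K * B); exists N.
  under eq_bigr do rewrite invfM.
  by rewrite -mulr_sumr ler_pdivlMl.
have f1E : f 0 1 = expi (l + v).
  by apply/funext => x; rewrite /f expr0 mul1r scale1r.
split; first exact: cmeasurable_expi.
move=> e e0; rewrite -f1E.
have e2 : 0 < e / 2 by rewrite divr_gt0.
(* One half of [e] is the distance bound, the other the tolerance in the definition of that
   bound. *)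
have := @bang R (fun j t b => dist_le (f j t) b) m' C C0 m'_gt0 m'_mono m'_div
  (fun j t b b' bb' => @Lp_dist_weak _ _ _ _ _ _ _ _ _ bb') Q_M Q_taylor Q0
  1 (e / 2) ler01 e2.
move=> /(_ _ e2)[g Fg Ng]; exists g => //.
by rewrite add0r; move: Ng; rewrite -splitr.
Qed.

End translation.
End moment_growth.

(** * Density *)

Section Cspan_linear.
Context {T : Type} {R : realType}.
Variable F : set (T -> R[i]).

Lemma Cspan0 : Cspan F (fun=> 0).
Proof.
exists 0%N, (fun=> 0), (fun _ _ => 0); split; first by case.
by apply/funext => x; rewrite big_ord0.
Qed.

Lemma Cspan_mem f : F f -> Cspan F f.
Proof.
move=> Ff; exists 1%N, (fun=> 1), (fun=> f); split=> //.
by apply/funext => x; rewrite big_ord1 mul1r.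
Qed.

Lemma CspanD f g : Cspan F f -> Cspan F g -> Cspan F (fun x => f x + g x).
Proof.
move=> [k [c [u [Fu ->]]]] [l [d [v [Fv ->]]]].
exists (k + l)%N, (fun i => match fintype.split i with inl a => c a | inr b => d b end),
  (fun i => match fintype.split i with inl a => u a | inr b => v b end).
split=> [i|]; first by case: (fintype.split i).
apply/funext => x; rewrite big_split_ord /=; congr (_ + _); apply: eq_bigr => i _.
  by rewrite (unsplitK (inl i : 'I_k + 'I_l)).
by rewrite (unsplitK (inr i : 'I_k + 'I_l)).
Qed.

Lemma CspanZ a f : Cspan F f -> Cspan F (fun x => a * f x).
Proof.
move=> [k [c [u [Fu ->]]]]; exists k, (fun i => a * c i), u; split=> //.
by apply/funext => x; rewrite mulr_sumr; apply: eq_bigr => i _; rewrite mulrA.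
Qed.

Lemma Cspan_sub (P : (T -> R[i]) -> Prop) : P (fun=> 0) ->
  (forall f g, P f -> P g -> P (fun x => f x + g x)) ->
  (forall a f, P f -> P (fun x => a * f x)) ->
  (forall f, F f -> P f) -> forall f, Cspan F f -> P f.
Proof.
move=> P0 PD PZ FP f [k [c [u [Fu ->]]]].
elim: k c u Fu => [|k IH] c u Fu.
  by under eq_fun do rewrite big_ord0.
under eq_fun do rewrite big_ord_recl.
by apply: PD; [exact/PZ/FP/Fu|apply: (IH (fun i => c (lift ord0 i)) (fun i => u (lift ord0 i)))].
Qed.

End Cspan_linear.

Section density.
Context {R : realType} {n : nat}.
Variables (mu : {measure set (borelRn R n) -> \bar R}) (p : R).
Hypothesis p1 : 1 <= p.
Variables (C : R) (m : nat -> R).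
Hypothesis C0 : 0 < C.
Hypothesis m_gt0 : forall k, 0 < m k.
Hypothesis m_mono : forall k l, (k <= l)%N -> m k <= m l.
Hypothesis m_div : forall B : R, exists N, B <= \sum_(k < N) (m k)^-1.
Hypothesis moments : forall j, (cLnorm mu p
  (fun x : borelRn R n => (enorm x ^+ j)%:C%C) <= (C * \prod_(k < j) m k)%:E)%E.

Let M j := C * \prod_(k < j) m k.

Let M_ge0 j : 0 <= M j.
Proof. by rewrite mulr_ge0 ?ltW// prodr_gt0. Qed.

Let mu_fin := growth_finite_measure p1 moments.

(** Translation from the frequency [0] reaches every [v], since the functions required there are the
    polynomials [(v, x) ^ j]. *)
Lemma polyfun_dense : dense_in_Lp mu p (range (@polyfun R n)).
Proof.
have Fm f : range (@polyfun R n) f -> cmeasurable (f : borelRn R n -> R[i]).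
  by move=> [P _ <-]; have [] := poly_growth_polyfun P.
have F0 := @polyfun_cst R n 0.
have FD := @polyfunD R n.
have FZ := @polyfunZ R n.
split=> [_ [P _ <-]|f fLp].
  exact: (poly_growth_inLp p1 moments (poly_growth_polyfun P)).
have [|_ H e e0] := @Lp_closure_of_expi _ _ mu p _ p1 mu_fin F0 FD FZ Fm _ f fLp.
  move=> v; rewrite -[v]add0r.
  apply: (Lp_closure_expi_translate p1 C0 m_gt0 m_mono m_div moments F0 FD FZ Fm) => j.
  apply: Lp_closure_mem => //.
  by under [X in range _ X]eq_fun do rewrite expi0 mulr1; exact: polyfun_innerX.
by have [g Fg] := H e e0; rewrite add0r; exists g.
Qed.

Section exponentials.
Variable S : set 'rV[R]_n.
Local Notation F := (Cspan (expi @` S)).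
Local Notation cl := (@Lp_closure _ (borelRn R n) R mu p F).

Let F0 : F (fun=> 0) := Cspan0 _.
Let FD : forall f g, F f -> F g -> F (fun x => f x + g x) := @CspanD _ _ _.
Let FZ : forall c f, F f -> F (fun x => c * f x) := @CspanZ _ _ _.

Let F_growth f : F f -> poly_growth f.
Proof.
apply: Cspan_sub => {f}.
- exact: poly_growth_cst.
- by move=> f g; exact: poly_growthD.
- by move=> a f; apply: poly_growthM; exact: poly_growth_cst.
- move=> _ [l _ <-]; split; first exact: cmeasurable_expi.
  by exists 1, 0%N => x; rewrite normc_expi expr0 mulr1.
Qed.

Let Fm f : F f -> cmeasurable (f : borelRn R n -> R[i]).
Proof. by move=> /F_growth[]. Qed.

Lemma Lp_closure_expi_closure l : closure S l -> cl (expi l).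
Proof.
move=> Sl; apply: (@Lp_closure_lim _ (borelRn R n) R mu _ p1 F Fm); first exact: cmeasurable_expi.
(* A sup-norm distance below [d] gives [l1norm] at most [n * d], and the first-order Taylor bound an
   [L_p]-error of at most [2 * n * d * M 1]; the [1] keeps [K] positive. *)
move=> e e0; pose K := 2 * n%:R * M 1 + 1.
have K0 : 0 < K by rewrite ltr_wpDl// mulr_ge0 ?M_ge0// mulr_ge0.
pose d := e / K; have d0 : 0 < d by rewrite divr_gt0.
have [l' [Sl' ll']] := Sl _ (nbhsx_ballx l d d0).
exists (expi l'); first by apply: Lp_closure_mem => //; apply: Cspan_mem; exists l'.
have vd : l1norm (l - l') <= n%:R * d.
  rewrite /l1norm mulr_natl -[in leRHS](card_ord n) -sumr_const.
  apply: ler_sum => i _; have [_ /(_ 0 i)] := ll'.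
  by rewrite /ball /= !mxE => /ltW.
apply: (@le_trans _ _ (2 * (n%:R * d) * M 1)%:E).
  apply: (cLnorm_enorm_bound p1 moments).
  - by apply: cmeasurableB; exact: cmeasurable_expi.
  - by apply: mulr_ge0 => //; apply: mulr_ge0 => //; exact: ltW.
  move=> x.
  have -> : expi l x - expi l' x = expi l' x * (cis (inner (l - l') x) -
      \sum_(k < 1) 'i%C ^+ k * (inner (l - l') x ^+ k / k`!%:R)%:C%C).
    rewrite big_ord1 !expr0 invr1 !mulr1 mulrBr mulr1 -expiE -expiD.
    by rewrite [l' + _]addrC subrK.
  rewrite ComplexField.Normc.normcM normc_expi mul1r.
  apply: le_trans (cis_taylor _ _) _; rewrite !expr1 -mulrA ler_wpM2l//.
  by apply: le_trans (inner_le _ _) _; rewrite ler_wpM2r// enorm_ge0.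
rewrite lee_fin /d; apply: (@le_trans _ _ (e * ((2 * n%:R * M 1) / K))).
  by rewrite le_eqVlt; apply/orP; left; apply/eqP; ring.
by rewrite ler_piMr ?(ltW e0)// ler_pdivrMr// mul1r lerDl.
Qed.

(** Induction on [j]: the function for [j + 1] is [- i] times the derivative in direction [v], with
    respect to the frequency, of the one for [j]. The interior is open, so the difference quotients
    use frequencies covered by the induction hypothesis. *)
Lemma Lp_closure_innerX_expi v j l : (closure S)° l ->
  cl (fun x => (inner v x ^+ j)%:C%C * expi l x).
Proof.
elim: j l => [|j IH] l Ul.
  under eq_fun do rewrite expr0 mul1r.
  by apply: Lp_closure_expi_closure; exact: interior_subset.
apply: (@Lp_closure_lim _ (borelRn R n) R mu _ p1 F Fm).
  by apply: cmeasurableM; [exact: cmeasurable_innerX|exact: cmeasurable_expi].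
move=> e e0; pose L := l1norm v; have L0 : 0 <= L by exact: l1norm_ge0.
(* The difference quotient with step [h] has error at most [2 * h * L ^ (j + 2) * M (j + 2)], from
   the Taylor remainder of order [2] divided by [h]. *)
pose K := 2 * L ^+ j.+2 * M j.+2 + 1.
have K0 : 0 < K by rewrite ltr_wpDl// mulr_ge0 ?M_ge0// mulr_ge0 ?exprn_ge0.
have : \forall h \near (0 : R), (closure S)° (l + h *: v).
  have cont : (fun h : R => l + h *: v) @ (0 : R) --> l.
    have {2}-> : l = l + 0 *: v by rewrite scale0r addr0.
    by apply: cvgD; [exact: cvg_cst|apply: cvgZl; exact: cvg_id].
  by apply: cont; apply: open_nbhs_nbhs; split => //; exact: open_interior.
move=> /nbhs_ballP[d /= d0 hd].
pose h := Num.min (d / 2) (e / K).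
have h0 : 0 < h by rewrite lt_min !divr_gt0.
have Uh : (closure S)° (l + h *: v).
  apply: hd; rewrite /ball /= sub0r normrN gtr0_norm// gt_min; apply/orP; left.
  by rewrite ltr_pdivrMr// ltr_pMr// ltr1n.
(* This is [1 / (i h)], so that [c] cancels the factor [i h] in the linear Taylor term. *)
pose c : R[i] := - 'i%C * (h^-1)%:C%C.
exists (fun x => c * ((inner v x ^+ j)%:C%C * expi (l + h *: v) x -
                      (inner v x ^+ j)%:C%C * expi l x)).
  by apply: (@Lp_closureZ _ (borelRn R n) R mu _ p1 _ F0 FZ Fm); apply: (@Lp_closureB _ (borelRn R n) R mu _ p1 _ F0 FD FZ Fm); exact: IH.
apply: (@le_trans _ _ (2 * h * L ^+ j.+2 * M j.+2)%:E); last first.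
  rewrite lee_fin; apply: (@le_trans _ _ (2 * L ^+ j.+2 * M j.+2 * (e / K))).
    have -> : 2 * h * L ^+ j.+2 * M j.+2 = 2 * L ^+ j.+2 * M j.+2 * h by ring.
    have hK : h <= e / K by rewrite /h ge_min lexx orbT.
    by rewrite ler_wpM2l// mulr_ge0 ?M_ge0// mulr_ge0 ?exprn_ge0.
  by rewrite mulrA ler_pdivrMr// mulrC ler_wpM2l ?(ltW e0)// lerDl.
apply: (cLnorm_enorm_bound p1 moments).
- apply: cmeasurableB.
    by apply: cmeasurableM; [exact: cmeasurable_innerX|exact: cmeasurable_expi].
  apply: cmeasurableM; first exact: cmeasurable_cst.
  by apply: cmeasurableB; apply: cmeasurableM;
    try exact: cmeasurable_innerX; exact: cmeasurable_expi.
- by apply: mulr_ge0; [apply: mulr_ge0; rewrite ?(ltW h0)|exact: exprn_ge0].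
move=> x; set w := inner v x.
have -> : (w ^+ j.+1)%:C%C * expi l x - c * ((w ^+ j)%:C%C * expi (l + h *: v) x -
      (w ^+ j)%:C%C * expi l x) = - c * (w ^+ j)%:C%C * expi l x *
    (cis (h * w) - \sum_(k < 2) 'i%C ^+ k * ((h * w) ^+ k / k`!%:R)%:C%C).
  have -> : \sum_(k < 2) 'i%C ^+ k * ((h * w) ^+ k / k`!%:R)%:C%C =
      1 + 'i%C * (h * w)%:C%C :> R[i].
    rewrite big_ord_recl big_ord1 /= (_ : bump 0 0 = 1%N)// factS fact0 muln1.
    by rewrite !expr0 !expr1 !divr1 mul1r.
  rewrite expiD.
  rewrite (expiE (h *: v)) innerZl -/w.
  have hc : c * ('i%C * (h * w)%:C%C) = w%:C%C.
    rewrite /c !rmorphM /= mulrACA mulNr -expr2 sqr_i opprK mul1r mulrA.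
    by rewrite -rmorphM mulVf ?gt_eqF// mul1r.
  have -> : (w ^+ j.+1)%:C%C = c * ('i%C * (h * w)%:C%C) * (w ^+ j)%:C%C.
    by rewrite hc -rmorphM -exprS.
  move: (expi l x) (cis _) ('i%C * _) (w ^+ j)%:C%C => z q y u; ring.
rewrite !ComplexField.Normc.normcM normcN normc_expi mulr1 normcR normrX.
have -> : normc c = h^-1.
  by rewrite /c ComplexField.Normc.normcM normcN normci mul1r normcR gtr0_norm ?invr_gt0.
apply: (@le_trans _ _ (h^-1 * `|w| ^+ j * (2 * `|h * w| ^+ 2))).
  by rewrite ler_wpM2l ?mulr_ge0 ?invr_ge0 ?(ltW h0) ?exprn_ge0// cis_taylor.
have -> : h^-1 * `|w| ^+ j * (2 * `|h * w| ^+ 2) = 2 * h * `|w| ^+ j.+2.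
  rewrite normrM (gtr0_norm h0) !exprS; field; exact: lt0r_neq0.
rewrite -[leRHS]mulrA ler_wpM2l ?mulr_ge0 ?(ltW h0)//.
rewrite -exprMn lerXn2r ?nnegrE//; last exact: inner_le.
by rewrite mulr_ge0 ?enorm_ge0.
Qed.

Lemma expi_dense : somewhere_dense S -> dense_in_Lp mu p F.
Proof.
move=> [l Ul]; split=> [f /F_growth|f fLp].
  exact: (poly_growth_inLp p1 moments).
have [|_ H e e0] := @Lp_closure_of_expi _ _ mu p _ p1 mu_fin F0 FD FZ Fm _ f fLp.
  (* An arbitrary frequency [v] is reached from the interior point [l] by translation through
     [v - l]. *)
  move=> v; rewrite -[v](subrK l) addrC.
  apply: (Lp_closure_expi_translate p1 C0 m_gt0 m_mono m_div moments F0 FD FZ Fm) => j.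
  exact: Lp_closure_innerX_expi.
by have [g Fg] := H e e0; rewrite add0r; exists g.
Qed.

End exponentials.
End density.

(** * Determinacy *)

Lemma mass_approx d (T : measurableType d) (R : realType)
    (tau : {measure set T -> \bar R}) (A : set T) (f : T -> R) (e : R) :
  measurable A -> (tau setT < +oo)%E -> measurable_fun setT f ->
  (\int[tau]_x (`|\1_A x - f x|)%:E <= e%:E)%E ->
  `|fine (tau A) - \int[tau]_x f x| <= e.
Proof.
move=> mA tfin mf H.
have mg : measurable_fun setT (fun x => \1_A x - f x).
  by apply: measurable_funB => //; exact: measurable_indic.
have iA : tau.-integrable setT (EFin \o (\1_A : T -> R)).
  apply/integrableP; split; first by apply/measurable_EFinP; exact: measurable_indic.
  under eq_integral do rewrite gee0_abs ?lee_fin//.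
  by rewrite integral_indic// setIT (le_lt_trans _ tfin)// le_measure// inE.
have ig : tau.-integrable setT (EFin \o (fun x => \1_A x - f x)).
  apply/integrableP; split; first exact/measurable_EFinP.
  exact: le_lt_trans H (ltry _).
have -> : \int[tau]_x f x = \int[tau]_x \1_A x - \int[tau]_x (\1_A x - f x).
  rewrite -RintegralB//; apply: eq_Rintegral => x _.
  by rewrite opprB addrC subrK.
have -> : \int[tau]_x \1_A x = fine (tau A).
  by rewrite /Rintegral integral_indic// setIT.
rewrite opprB addrC subrK.
apply: le_trans (le_normr_Rintegral measurableT ig) _.
rewrite /Rintegral -lee_fin fineK//.
by rewrite ge0_fin_numE ?(le_lt_trans H (ltry _))// integral_ge0.
Qed.

Section determinacy.
Context {R : realType} {n : nat}.
Variable mu : {measure set (borelRn R n) -> \bar R}.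
Variables (C : R) (m : nat -> R).
Hypothesis C0 : 0 < C.
Hypothesis m_gt0 : forall k, 0 < m k.
Hypothesis m_mono : forall k l, (k <= l)%N -> m k <= m l.
Hypothesis m_div : forall B : R, exists N, B <= \sum_(k < N) (m k)^-1.
Hypothesis moments : forall j, (cLnorm mu 2
  (fun x : borelRn R n => (enorm x ^+ j)%:C%C) <= (C * \prod_(k < j) m k)%:E)%E.

Let M j := \prod_(k < j) m k.
Let M_gt0 j : 0 < M j. Proof. exact: prodr_gt0. Qed.
Let ge1_2 : 1 <= 2 :> R. Proof. by rewrite ler1n. Qed.

Let me j : measurable_fun setT (fun x : borelRn R n => enorm x ^+ j).
Proof. by apply: measurable_funX; exact: measurable_enorm. Qed.

(** Squared [L_2]-norms give the moments of even order, whose integrands are polynomials and hence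
    shared by any measure with the same polynomial integrals. This is why the moment hypothesis is
    taken for exponent [2]. *)
Let even_moments j :
  (\int[mu]_x (enorm (x : 'rV[R]_n) ^+ (j * 2))%:E <= ((C * M j) ^+ 2)%:E)%E.
Proof.
have := moments j.
rewrite cLnormE => H.
have I0 := Lp_integral_ge0 mu 2 (fun x : borelRn R n => (enorm x ^+ j)%:C%C).
have -> : (\int[mu]_x (enorm (x : 'rV[R]_n) ^+ (j * 2))%:E =
    (Lp_integral mu 2 (fun x : borelRn R n => (enorm x ^+ j)%:C%C) `^ 2^-1) `^ 2)%E.
  rewrite -poweRrM mulVf ?poweRe1//; apply: eq_integral => x _.
  rewrite normcR ger0_norm ?exprn_ge0 ?enorm_ge0//.
  by rewrite powR_mulrn ?exprn_ge0 ?enorm_ge0// exprM.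
have -> : ((C * M j) ^+ 2)%:E = ((C * M j)%:E `^ 2)%E.
  by rewrite poweR_EFin powR_mulrn// mulr_ge0 ?ltW.
apply: gt0_ler_poweR => //; rewrite in_itv/= leey andbT ?poweR_ge0//.
by rewrite lee_fin mulr_ge0 ?ltW.
Qed.

Lemma growth_finite_moments : finite_moments mu.
Proof.
move=> a a0; have [j ja] : exists j : nat, a <= (j * 2)%:R.
  exists (Num.bound a); have := archi_boundP a0 => /ltW/le_trans; apply.
  by rewrite ler_nat leq_pmulr.
have mfin := growth_finite_measure ge1_2 moments.
apply: (@le_lt_trans _ _ (\int[mu]_x (1 + enorm (x : 'rV[R]_n) ^+ (j * 2))%:E)%E).
  apply: ge0_le_integral => //.
  - by move=> x _; rewrite lee_fin powR_ge0.
  - apply/measurable_EFinP; apply: (@measurableT_comp _ _ _ _ _ _ (@powR R ^~ a)) => //.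
    exact: measurable_enorm.
  - by apply/measurable_EFinP/measurable_funD => //; exact: measurable_cst.
  - move=> x _; rewrite lee_fin; have s0 := enorm_ge0 x.
    have [s1|/ltW s1] := leP (enorm x) 1.
      apply: (@le_trans _ _ 1); last by rewrite lerDl exprn_ge0.
      have <- : 1 `^ a = 1 :> R by rewrite powR1.
      by apply: ge0_ler_powR; rewrite ?nnegrE.
    apply: (@le_trans _ _ (enorm x `^ (j * 2)%:R)).
      by apply: ler_powR.
    by rewrite powR_mulrn// lerDr.
under eq_integral do rewrite EFinD.
rewrite ge0_integralD//.
- by rewrite integral_cst// mul1e lte_add_pinfty// (le_lt_trans (even_moments j) (ltry _)).
- by move=> x _; rewrite lee_fin exprn_ge0// enorm_ge0.
- exact/measurable_EFinP.
Qed.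

Lemma growth_determinate : determinate mu.
Proof.
split; first exact: growth_finite_moments.
move=> nu nufin Peq A mA.
have mufin := growth_finite_moments.
have finE (tau : {measure set (borelRn R n) -> \bar R}) : finite_moments tau ->
    forall j : nat, (\int[tau]_x (enorm (x : 'rV[R]_n) ^+ j)%:E < +oo)%E.
  move=> H j; have := H j%:R (ler0n _ _).
  by under eq_integral do rewrite powR_mulrn ?enorm_ge0//.
have mu_nu j : (\int[nu]_x (enorm (x : 'rV[R]_n) ^+ (j * 2))%:E =
                \int[mu]_x (enorm (x : 'rV[R]_n) ^+ (j * 2))%:E)%E.
  have [P _ PE] : range (@polyfun R n) (fun x => (enorm x ^+ (j * 2))%:C%C).
    under [X in range _ X]eq_fun do rewrite mulnC exprM sqr_sqrtr ?inner_ge0//.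
    elim: j => [|j IH].
      by under [X in range _ X]eq_fun do rewrite expr0; exact: polyfun_cst.
    under [X in range _ X]eq_fun do rewrite exprS rmorphM.
    apply: polyfunM IH; rewrite /inner; elim: (index_enum _) => [|i s IH].
      by under [X in range _ X]eq_fun do rewrite big_nil; exact: polyfun_cst.
    under [X in range _ X]eq_fun do rewrite big_cons rmorphD rmorphM.
    have coordP : range (@polyfun R n) (fun x => (x 0 i)%:C%C).
      have := @polyfun_innerX R n (delta_mx 0 i) 1.
      by under [X in range _ X]eq_fun do rewrite inner_delta expr1.
    by apply: polyfunD IH; exact: polyfunM.
  (* [Rintegral] is the [fine] part of an extended integral, so this equality alone would not
     exclude an infinite value; finiteness of the moments lifts it. *)
  have := Peq P; rewrite PE /cintegral => -[+ _]; rewrite /Rintegral /= => fE.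
  have fint tau : finite_moments tau ->
      (\int[tau]_x (enorm (x : 'rV[R]_n) ^+ (j * 2))%:E)%E \is a fin_num.
    move=> /finE H; rewrite ge0_fin_numE// integral_ge0// => x _.
    by rewrite lee_fin exprn_ge0// enorm_ge0.
  by rewrite -(fineK (fint _ nufin)) fE fineK// fint.
pose sigma : {measure set (borelRn R n) -> \bar R} := measure_add mu nu.
have sigmaE (f : borelRn R n -> R) : measurable_fun setT f -> (forall x, 0 <= f x) ->
    (\int[sigma]_x (f x)%:E = \int[mu]_x (f x)%:E + \int[nu]_x (f x)%:E)%E.
  move=> mf f0; rewrite ge0_integral_measure_add//.
    by move=> x _; rewrite lee_fin.
  exact/measurable_EFinP.
have sigma_even j :
    (\int[sigma]_x (enorm (x : 'rV[R]_n) ^+ (j * 2))%:E <= (2 * (C * M j) ^+ 2)%:E)%E.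
  rewrite sigmaE//; last by move=> x; rewrite exprn_ge0// enorm_ge0.
  rewrite mu_nu mulr_natl mulr2n EFinD; apply: leeD; exact: even_moments.
have sigmaT : (sigma setT <= (2 * C ^+ 2)%:E)%E.
  have := sigma_even 0%N; rewrite /M big_ord0 mulr1; apply: le_trans.
  under eq_integral do rewrite expr0.
  by rewrite integral_cst// mul1e.
(* The even moments of [sigma] control its [L_1]-moments by the same sequence [m]; only the constant
   changes. *)
have sigma_moments j : (cLnorm sigma 1
    (fun x : borelRn R n => (enorm x ^+ j)%:C%C) <= (2 * C ^+ 2 * M j)%:E)%E.
  apply: cLnorm_le => //; first by rewrite mulr_ge0 ?mulr_ge0 ?exprn_ge0 ?ltW.
  rewrite powRr1; last by rewrite mulr_ge0 ?mulr_ge0 ?exprn_ge0 ?ltW.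
  rewrite /Lp_integral.
  pose c := M j / 2; pose b := (2 * M j)^-1.
  have c0 : 0 <= c by rewrite divr_ge0 ?ltW.
  have b0 : 0 <= b by rewrite invr_ge0 mulr_ge0 ?ltW.
  (* AM-GM: [2 s <= s ^ 2 / M + M] with [s = |x| ^ j] *)
  apply: (@le_trans _ _
      (\int[sigma]_x (c%:E + b%:E * (enorm (x : 'rV[R]_n) ^+ (j * 2))%:E))%E).
    apply: ge0_le_integral => //.
    - by move=> x _; rewrite lee_fin powR_ge0.
    - apply/measurable_EFinP; apply: measurable_normc_powR.
      by apply: cmeasurableR.
    - apply: emeasurable_funD; first exact: measurable_cst.
      by apply: emeasurable_funM; [exact: measurable_cst|exact/measurable_EFinP].
    - move=> x _; rewrite powRr1 ?normc_ge0// normcR -EFinM -EFinD lee_fin.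
      have s0 : 0 <= enorm x ^+ j by rewrite exprn_ge0// enorm_ge0.
      rewrite ger0_norm// exprM; move: s0; set s := enorm x ^+ j => s0.
      have -> : c + b * s ^+ 2 = s + (2 * M j)^-1 * (M j - s) ^+ 2.
        by rewrite /c /b; field; rewrite gt_eqF.
      by rewrite lerDl mulr_ge0// sqr_ge0.
  have se0 x : (0%R <= (enorm (x : 'rV[R]_n) ^+ (j * 2))%:E)%E.
    by rewrite lee_fin exprn_ge0// enorm_ge0.
  rewrite ge0_integralD//; last 2 first.
    by move=> x _; rewrite mule_ge0.
    by apply: emeasurable_funM; [exact: measurable_cst|exact/measurable_EFinP].
  rewrite ge0_integralZl//; last exact/measurable_EFinP.
  rewrite integral_cst//.
  apply: (@le_trans _ _ (c%:E * (2 * C ^+ 2)%:E + b%:E * (2 * (C * M j) ^+ 2)%:E)%E).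
    by apply: leeD; rewrite lee_wpmul2l ?lee_fin.
  rewrite -!EFinM -EFinD lee_fin le_eqVlt; apply/orP; left; apply/eqP.
  by rewrite /c /b exprMn; field; rewrite gt_eqF.
have C2 : 0 < 2 * C ^+ 2 by rewrite mulr_gt0 ?exprn_gt0.
have [_ dense] := polyfun_dense (lexx 1) C2 m_gt0 m_mono m_div sigma_moments.
have sT : (sigma setT < +oo)%E by exact: le_lt_trans sigmaT (ltry _).
have sE : sigma setT = (mu setT + nu setT)%E by exact: measure_addE.
have muT : (mu setT < +oo)%E.
  by apply: le_lt_trans sT; rewrite sE leeDl.
have nuT : (nu setT < +oo)%E.
  by apply: le_lt_trans sT; rewrite sE leeDr.
have mA1 : cmeasurable (fun x : borelRn R n => (\1_A x)%:C%C : R[i]).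
  exact/cmeasurableR/measurable_indic.
have ALp : inLp sigma 1 (fun x : borelRn R n => (\1_A x)%:C%C).
  split=> //; apply: le_lt_trans (cLnorm_cst_lty 1 sT 1).
  apply: (cLnorm_mono _ (lexx 1)) => // x.
  by rewrite normcR indicE; case: (_ \in _); rewrite ?normr0 ?normr1.
(* A polynomial close to the indicator of [A] in [L_1] of [sigma] is close for both summands [mu]
   and [nu], and its two integrals agree. *)
have close e : 0 < e -> `|fine (nu A) - fine (mu A)| <= e.
  move=> e0; have e2 : 0 < e / 2 by rewrite divr_gt0.
  have [_ [P _ <-]] := dense _ ALp _ e2.
  have [mP _] := poly_growth_polyfun P.
  rewrite cLnormE invr1 poweRe1 ?Lp_integral_ge0// /Lp_integral.
  pose D := fun x : borelRn R n => normc ((\1_A x)%:C%C - polyfun P x).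
  have mD : measurable_fun setT D by apply: measurable_normc; exact: cmeasurableB.
  have D0 x : 0 <= D x by exact: normc_ge0.
  have -> : (\int[sigma]_x (normc ((\1_A x)%:C%C - polyfun P x) `^ 1)%:E =
             \int[sigma]_x (D x)%:E)%E.
    by apply: eq_integral => x _; rewrite powRr1 ?normc_ge0.
  rewrite sigmaE// => Dlt.
  have I0 (tau : {measure set (borelRn R n) -> \bar R}) : (0 <= \int[tau]_x (D x)%:E)%E.
    by apply: integral_ge0 => x _; rewrite lee_fin.
  have part (tau : {measure set (borelRn R n) -> \bar R}) : (tau setT < +oo)%E ->
      (\int[tau]_x (D x)%:E <= (e / 2)%:E)%E ->
      `|fine (tau A) - complex.Re (cintegral tau (polyfun P))| <= e / 2.
    move=> tT H; apply: mass_approx => //; first by case: mP.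
    apply: le_trans H; apply: ge0_le_integral => //.
    - apply/measurable_EFinP; apply: measurableT_comp => //.
      by apply: measurable_funB; [exact: measurable_indic|case: mP].
    - by apply/measurable_EFinP.
    - move=> x _; rewrite lee_fin /D; apply: le_trans (Re_le_normc _).
      by case: (polyfun P x) => a b /=.
  have h1 : `|fine (nu A) - complex.Re (cintegral nu (polyfun P))| <= e / 2.
    by apply: part => //; apply: le_trans (ltW Dlt); rewrite leeDr.
  have h2 : `|fine (mu A) - complex.Re (cintegral mu (polyfun P))| <= e / 2.
    by apply: part => //; apply: le_trans (ltW Dlt); rewrite leeDl.
  move: h1 h2; rewrite Peq !ler_norml => /andP[a1 a2] /andP[b1 b2].
  by apply/andP; split; lra.
have Afin (tau : {measure set (borelRn R n) -> \bar R}) : (tau setT < +oo)%E ->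
    tau A \is a fin_num.
  by move=> tT; rewrite ge0_fin_numE// (le_lt_trans _ tT)// le_measure// inE.
rewrite -(fineK (Afin _ nuT)) -(fineK (Afin _ muT)); congr EFin.
apply/eqP; rewrite -subr_eq0 -normr_le0; apply/ler_addgt0Pr => e e0.
by rewrite add0r close.
Qed.

End determinacy.

(** * The Carleman sequence of an exponential weight *)

Section weight.
Context {R : realType}.
Local Notation leb := (@lebesgue_measure R).
Implicit Types a b s t : R.

Lemma measurable_inv_itv (i : interval R) : [set` i] `<=` `](0 : R), +oo[%classic ->
  measurable_fun [set` i] (fun s : R => s^-1).
Proof.
move=> i0; have m0 : measurable_fun `](0 : R), +oo[%classic (fun s : R => s^-1).
  apply: open_continuous_measurable_fun; first exact: rray_open.
  move=> x; rewrite inE/= in_itv/= andbT => x0.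
  by apply: inv_continuous; rewrite gt_eqF.
by apply: measurable_funS i0 m0; exact: measurable_itv.
Qed.

Lemma measurable_invsq_itv (i : interval R) : [set` i] `<=` `](0 : R), +oo[%classic ->
  measurable_fun [set` i] (fun s : R => s ^- 2).
Proof.
move=> i0; have -> : (fun s : R => s ^- 2) = (fun s => s^-1 ^+ 2).
  by apply/funext => s; rewrite exprVn.
by apply: measurable_funX; exact: measurable_inv_itv.
Qed.

Lemma integral_invsq a : 0 < a ->
  (\int[leb]_(s in `[a, +oo[) (s ^- 2)%:E = (a^-1)%:E)%E.
Proof.
move=> a0.
have der (x : R) : 0 < x -> is_derive x 1 (fun s : R => - s^-1) (x ^- 2).
  move=> x0; have x1 : id x != 0 :> R by rewrite gt_eqF.
  have := is_deriveN (is_deriveV x1 (is_derive_id x (1 : R))).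
  by rewrite /GRing.scale /= mulr1 opprK.
have cinv (x : R) : 0 < x -> {for x, continuous (fun s : R => s^-1)}.
  by move=> x0; apply: inv_continuous; rewrite gt_eqF.
rewrite (@ge0_continuous_FTC2y _ _ (fun s => - s^-1) _ 0).
- by rewrite -EFinB sub0r opprK.
- by move=> x ax; rewrite invr_ge0 exprn_ge0// (le_trans (ltW a0)).
- apply: continuous_in_subspaceT => x; rewrite inE /= in_itv/= andbT => ax.
  have x0 := lt_le_trans a0 ax.
  apply: (@continuous_comp _ _ _ (fun s : R => s ^+ 2) (fun s : R => s^-1)).
    exact: exprn_continuous.
  by apply: cinv; rewrite exprn_gt0.
- rewrite -[X in _ --> X]oppr0; apply: cvgN; apply/gtr0_cvgV0; last exact: cvg_id.
  exact: nbhs_pinfty_gt.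
- by move=> x ax; have [] := der x (lt_trans a0 ax).
- by apply: cvg_at_right_filter; apply: cvgN; exact: cinv.
- move=> x; rewrite in_itv/= andbT => ax.
  by rewrite derive1E; have dx := der x (lt_trans a0 ax); rewrite derive_val.
Qed.

Lemma integral_inv a b : 0 < a -> a < b ->
  (\int[leb]_(s in `]a, b[) (s^-1)%:E = (ln b - ln a)%:E)%E.
Proof.
move=> a0 ab.
have cinv (x : R) : 0 < x -> {for x, continuous (fun s : R => s^-1)}.
  by move=> x0; apply: inv_continuous; rewrite gt_eqF.
have der (x : R) : 0 < x -> is_derive x 1 (@ln R) x^-1 by exact: is_derive1_ln.
have cln (x : R) : 0 < x -> {for x, continuous (@ln R)} by exact: continuous_ln.
have mi c : measurable_fun [set` Interval (BRight a) (BSide c b)]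
    (fun s : R => (s^-1)%:E).
  apply/measurable_EFinP; apply: measurable_inv_itv => x /=.
  by rewrite !in_itv/= andbT => /andP[/(lt_trans a0)].
rewrite integral_itv_bndo_bndc// integral_itv_obnd_cbnd//.
rewrite (@continuous_FTC2 _ _ (@ln R))//.
- apply: continuous_in_subspaceT => x; rewrite inE /= in_itv/= => /andP[ax _].
  exact/cinv/(lt_le_trans a0).
- split.
  + by move=> x; rewrite in_itv/= => /andP[ax _]; have [] := der x (lt_trans a0 ax).
  + by apply: cvg_at_right_filter; exact: cln.
  + by apply: cvg_at_left_filter; apply: cln; exact: lt_trans ab.
- move=> x; rewrite in_itv/= => /andP[ax _].
  by rewrite derive1E; have dx := der x (lt_trans a0 ax); rewrite derive_val.
Qed.

Variables (r : R) (rho : R -> R) (p : R).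
Hypothesis r0 : 0 < r.
Hypothesis p0 : 0 < p.
Hypothesis rho_ge0 : forall s, r < s -> 0 <= rho s.
Hypothesis rho_mono : forall s t, r < s -> s <= t -> rho s <= rho t.
Hypothesis rho_measurable : measurable_fun `]r, +oo[%classic rho.
Hypothesis rho_div :
  (\int[leb]_(s in `]r, +oo[) (rho s / s ^+ 2)%:E = +oo)%E.

Let pos s : r < s -> 0 < s. Proof. exact: lt_trans. Qed.

Let itv_pos : `]r, +oo[%classic `<=` `](0 : R), +oo[%classic.
Proof. by move=> x /=; rewrite !in_itv/= !andbT; exact: pos. Qed.

Let measurable_inv := measurable_inv_itv itv_pos.
Let measurable_invsq := measurable_invsq_itv itv_pos.

(** Its integral is at most [1 / t], which links the integral of [rho s / s ^ 2] to the sum of the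
    inverse thresholds. *)
Let tail t s := s ^- 2 * \1_`[t, +oo[%classic s.

Let indic_itv t s : t <= s -> \1_`[t, +oo[%classic s = 1 :> R.
Proof. by move=> ts; rewrite indicE mem_set//= in_itv/= andbT. Qed.

Let tail_ge0 t s : 0 <= tail t s.
Proof. by rewrite mulr_ge0 ?invr_ge0 ?sqr_ge0// indicE. Qed.

Let measurable_tail t : measurable_fun `]r, +oo[%classic (tail t).
Proof.
by apply: measurable_funM => //; apply: measurable_indic.
Qed.

Let integral_tail t : r <= t ->
  (\int[leb]_(s in `]r, +oo[) (tail t s)%:E <= (t^-1)%:E)%E.
Proof.
move=> rt; have t0 := lt_le_trans r0 rt; rewrite -(integral_invsq t0).
have -> : (fun s => (tail t s)%:E) = (fun s => (s ^- 2)%:E) \_ `[t, +oo[%classic.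
  apply/funext => s; rewrite /patch /tail indicE.
  by case: ifP => _; rewrite ?mulr1 ?mulr0.
rewrite -integral_mkcondr; apply: ge0_subset_integral => //.
- by apply: measurableI; exact: measurable_itv.
- apply/measurable_EFinP; apply: measurable_invsq_itv => x /=.
  by rewrite !in_itv/= !andbT; exact: lt_le_trans.
- by move=> s _; rewrite lee_fin invr_ge0 sqr_ge0.
Qed.

Let integrand_ge0 s : `]r, +oo[%classic s -> (0%R <= (rho s / s ^+ 2)%:E)%E.
Proof.
rewrite /= in_itv/= andbT => rs.
by rewrite lee_fin divr_ge0 ?rho_ge0// exprn_ge0// ltW// pos.
Qed.

Let measurable_integrand :
  measurable_fun `]r, +oo[%classic (fun s => (rho s / s ^+ 2)%:E).
Proof. by apply/measurable_EFinP; exact: measurable_funM. Qed.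

Let level c : set R := [set t | t = r \/ r < t /\ rho t <= c].

Let level_ubound c : 0 <= c -> has_ubound (level c).
Proof.
move=> c0; apply: contrapT => nub.
have rho_le s : r < s -> rho s <= c.
  move=> rs; apply: contrapT => /negP; rewrite -ltNge => cs.
  apply: nub; exists s => t [->|[rt rtc]]; first exact: ltW.
  rewrite leNgt; apply/negP => st.
  by have := lt_le_trans cs (le_trans (rho_mono rs (ltW st)) rtc); rewrite ltxx.
have : (\int[leb]_(s in `]r, +oo[) (rho s / s ^+ 2)%:E < +oo)%E.
  apply: (@le_lt_trans _ _ (\int[leb]_(s in `]r, +oo[) (c%:E * (tail r s)%:E))%E).
    apply: ge0_le_integral => //.
    - apply: emeasurable_funM; first exact: measurable_cst.
      by apply/measurable_EFinP; exact: measurable_tail.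
    - move=> s /=; rewrite in_itv/= andbT => rs.
      rewrite -EFinM lee_fin /tail (indic_itv (ltW rs)) mulr1.
      by rewrite ler_wpM2r ?invr_ge0 ?sqr_ge0// rho_le.
  rewrite ge0_integralZl//; last 2 first.
  - by apply/measurable_EFinP; exact: measurable_tail.
  - by move=> s _; rewrite lee_fin; exact: tail_ge0.
  by apply: (@le_lt_trans _ _ (c%:E * (r^-1)%:E)%E); rewrite ?lee_wpmul2l ?integral_tail// -EFinM ltry.
by rewrite rho_div ltxx.
Qed.

(* Adding [r] to the level set makes it nonempty; it is bounded because a bounded
   [rho] would make the integral of [rho s / s ^ 2] finite. *)
Definition threshold (k : nat) : R := sup (level (p * k.+1%:R)).

Let pk0 k : 0 <= p * k.+1%:R. Proof. by rewrite mulr_ge0// ltW. Qed.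

Let level_has_sup k : has_sup (level (p * k.+1%:R)).
Proof. by split; [exists r; left|exact: level_ubound]. Qed.

Lemma threshold_ge k : r <= threshold k.
Proof. by apply: ub_le_sup; [exact: level_ubound|left]. Qed.

Lemma threshold_gt0 k : 0 < threshold k.
Proof. exact: lt_le_trans (threshold_ge k). Qed.

Lemma threshold_mono k l : (k <= l)%N -> threshold k <= threshold l.
Proof.
move=> kl; apply: le_sup.
- move=> t Lt; exists t; split => //; case: Lt => [->|[rt rc]]; [by left|right].
  by split=> //; apply: le_trans rc _; rewrite ler_pM2l// ler_nat.
- by exists r; left.
- exact: level_has_sup.
Qed.

Let rho_gt k s : threshold k < s -> p * k.+1%:R < rho s.
Proof.
move=> ks; have rs := le_lt_trans (threshold_ge k) ks.
rewrite ltNge; apply/negP => H.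
have := ub_le_sup (level_ubound (pk0 k)) (or_intror (conj rs H)).
by rewrite leNgt ks.
Qed.

Let rho_le k s : r < s -> s < threshold k -> rho s <= p * k.+1%:R.
Proof.
move=> rs sk; have [t [tr|[rt H]] st] := sup_gt (level_has_sup k).1 sk.
  by move: st; rewrite tr => /(lt_trans rs); rewrite ltxx.
exact: le_trans (rho_mono rs (ltW st)) H.
Qed.

(** Up to the factor [p], [rho s] is at most [1] plus the number of thresholds not exceeding [s].
    Dividing by [s ^ 2] and integrating termwise, bounded partial sums would bound the integral by
    [p / r + p * B]. *)
Lemma threshold_div (B : R) : exists N, B <= \sum_(k < N) (threshold k)^-1.
Proof.
apply: contrapT => /forallNP H.
have HB N : \sum_(k < N) (threshold k)^-1 <= B by rewrite ltW// ltNge; apply/negP.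
have : (\int[leb]_(s in `]r, +oo[) (rho s / s ^+ 2)%:E < +oo)%E.
  pose u (k : nat) s : \bar R := (p * tail (threshold k) s)%:E.
  have u0 k s : (0 <= u k s)%E by rewrite lee_fin mulr_ge0// ltW.
  have mu k : measurable_fun `]r, +oo[%classic (u k).
    by apply/measurable_EFinP; exact: measurable_funM.
  have msum : measurable_fun `]r, +oo[%classic (fun s => \sum_(0 <= k <oo) u k s)%E.
    by apply: ge0_emeasurable_sum => k *; [exact: u0|exact: mu].
  have mtail : measurable_fun `]r, +oo[%classic (fun s => (p * tail r s)%:E).
    by apply/measurable_EFinP; exact: measurable_funM.
  have int_ptail t : r <= t ->
      (\int[leb]_(s in `]r, +oo[) (p * tail t s)%:E <= (p / t)%:E)%E.
    move=> rt; under eq_integral do rewrite EFinM.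
    rewrite ge0_integralZl ?lee_fin ?(ltW p0)//; last 2 first.
    - by apply/measurable_EFinP; exact: measurable_tail.
    - by move=> s _; rewrite lee_fin; exact: tail_ge0.
    by rewrite EFinM lee_wpmul2l ?integral_tail// lee_fin (ltW p0).
  apply: (@le_lt_trans _ _ (\int[leb]_(s in `]r, +oo[)
      ((p * tail r s)%:E + \sum_(0 <= k <oo) u k s))%E).
    apply: ge0_le_integral => //.
    - exact: emeasurable_funD.
    - move=> s /=; rewrite in_itv/= andbT => rs.
      (* If some threshold exceeds [s], take the least such index [N]: all [N] earlier indicators
         are [1]. Otherwise every indicator is [1] and any [N] above [rho s / p] will do. *)
      have [N HN] : exists N, rho s <= p * (1 + \sum_(k < N) \1_`[threshold k, +oo[%classic s).
        have [[k sk]|nk] := pselect (exists k, s < threshold k).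
          have [N sN minN] := ex_minnP (ex_intro (fun k => s < threshold k) k sk).
          exists N; apply: le_trans (rho_le rs sN) _.
          rewrite ler_pM2l// -natr1 addrC lerD2l -[X in X%:R]card_ord -sumr_const.
          apply: ler_sum => i _; rewrite indic_itv// leNgt.
          by apply/negP => /minN; rewrite leqNgt ltn_ord.
        exists (Num.bound (rho s / p)).
        have : rho s / p < (Num.bound (rho s / p))%:R.
          by apply: archi_boundP; rewrite divr_ge0 ?rho_ge0// ltW.
        rewrite ltr_pdivrMr// mulrC => /ltW/le_trans; apply.
        rewrite ler_pM2l// -[X in X%:R]card_ord -sumr_const -[leLHS]add0r lerD//.
        apply: ler_sum => i _; rewrite indic_itv// leNgt.
        by apply/negP => si; apply: nk; exists i.
      apply: (@le_trans _ _ ((p * tail r s)%:E + \sum_(0 <= k < N) u k s)%E).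
        rewrite sumEFin -EFinD lee_fin big_mkord.
        have -> : p * tail r s + \sum_(k < N) p * tail (threshold k) s =
            p * (1 + \sum_(k < N) \1_`[threshold k, +oo[%classic s) / s ^+ 2.
          rewrite /tail (indic_itv (ltW rs)) mulr1.
          rewrite mulrDr mulr1 mulrDl mulr_sumr mulr_suml; congr (_ + _).
          by apply: eq_bigr => i _; rewrite mulrA mulrAC.
        by rewrite ler_wpM2r ?invr_ge0 ?sqr_ge0.
      by apply: leeD => //; exact: nneseries_lim_ge.
  rewrite ge0_integralD//; last 2 first.
  - by move=> s _; rewrite lee_fin mulr_ge0// ltW.
  - by move=> s _; exact: nneseries_ge0.
  apply: lte_add_pinfty; first by apply: le_lt_trans (int_ptail _ (lexx r)) (ltry _).
  rewrite integral_nneseries//.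
  apply: (@le_lt_trans _ _ (p * B)%:E); last exact: ltry.
  apply: lime_le; first by apply: is_cvg_nneseries => k _ _; exact: integral_ge0.
  apply: nearW => N.
  apply: (@le_trans _ _ (\sum_(0 <= k < N) (p / threshold k)%:E)%E).
    by apply: lee_sum => k _; apply: int_ptail; exact: threshold_ge.
  by rewrite sumEFin lee_fin -mulr_sumr big_mkord ler_pM2l.
by rewrite rho_div ltxx.
Qed.

(** After taking logarithms, each factor contributes [p (ln t - ln (threshold k))], the integral of
    [p / s] from [threshold k] to [t]. The sum of these integrands is at most [rho s / s], because
    [rho s] exceeds [p (k + 1)] beyond [threshold k]. *)
Lemma threshold_growth j t : r < t ->
  (((t ^+ j / \prod_(k < j) threshold k) `^ p)%:E <=
   expeR (\int[leb]_(s in `]r, t[) (rho s / s)%:E))%E.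
Proof.
move=> rt; have t0 := pos rt.
have P0 : 0 < \prod_(k < j) threshold k by apply: prodr_gt0 => k _; exact: threshold_gt0.
have X0 : 0 < t ^+ j / \prod_(k < j) threshold k by rewrite divr_gt0// exprn_gt0.
have lnX : p * ln (t ^+ j / \prod_(k < j) threshold k) =
    \sum_(k < j) p * (ln t - ln (threshold k)).
  rewrite -mulr_sumr; congr (p * _).
  elim: j {P0 X0} => [|j IH]; first by rewrite !big_ord0 expr0 divr1 ln1.
  have Pj : 0 < \prod_(k < j) threshold k by apply: prodr_gt0 => k _; exact: threshold_gt0.
  have tj := threshold_gt0 j.
  rewrite !big_ord_recr /= -IH exprSr invfM mulrACA [LHS]lnM ?posrE ?divr_gt0 ?exprn_gt0//.
  by congr (_ + _); rewrite ln_div ?posrE.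
have -> : ((t ^+ j / \prod_(k < j) threshold k) `^ p)%:E =
    expeR (p * ln (t ^+ j / \prod_(k < j) threshold k))%:E.
  by rewrite /powR gt_eqF.
rewrite lee_expeR lnX -sumEFin.
pose v (k : nat) s : R := p * (s^-1 * \1_`]threshold k, +oo[%classic s).
have itvE : `]r, t[%classic `<=` `]r, +oo[%classic.
  by move=> x /=; rewrite !in_itv/= andbT => /andP[].
have mitv (f : R -> R) : measurable_fun `]r, +oo[%classic f ->
    measurable_fun `]r, t[%classic f.
  by move=> mf; apply: measurable_funS itvE mf; exact: measurable_itv.
have itv0 s : `]r, t[%classic s -> 0 < s.
  by move=> /itvE /=; rewrite in_itv/= andbT; exact: pos.
have v0 k s : `]r, t[%classic s -> 0 <= v k s.
  by move=> /itv0/ltW s0; apply: mulr_ge0 (ltW p0) _; rewrite mulr_ge0 ?invr_ge0// indicE.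
have mv k : measurable_fun `]r, t[%classic (v k).
  apply: measurable_funM; first exact: measurable_cst.
  apply: measurable_funM; first exact: mitv.
  by apply: measurable_indic; exact: measurable_itv.
have int_v k : ((p * (ln t - ln (threshold k)))%:E <= \int[leb]_(s in `]r, t[) (v k s)%:E)%E.
  (* When [t] has not passed the threshold, the logarithmic term is nonpositive. *)
  have [tk|kt] := leP t (threshold k).
    apply: (@le_trans _ _ 0%E).
      by rewrite lee_fin pmulr_rle0// subr_le0 ler_ln ?posrE// threshold_gt0.
    by apply: integral_ge0 => s rst; rewrite lee_fin v0.
  rewrite EFinM -(integral_inv (threshold_gt0 k) kt) -ge0_integralZl ?lee_fin ?(ltW p0)//.
  - have -> : `]threshold k, t[%classic = `]r, t[%classic `&` `]threshold k, +oo[%classic.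
      apply/seteqP; split=> x /=; rewrite !in_itv/= ?andbT.
        by move=> /andP[a b]; split=> //; rewrite b (le_lt_trans (threshold_ge k) a).
      by move=> [/andP[_ ->] ->].
    rewrite integral_mkcondr le_eqVlt; apply/orP; left; apply/eqP.
    apply: eq_integral => s _; rewrite /patch /v indicE.
    by case: ifP => _; rewrite ?mulr1 ?mulr0// EFinM.
  - apply/measurable_EFinP; apply: measurable_inv_itv => x /=.
    by rewrite !in_itv/= andbT => /andP[a _]; exact: lt_trans (threshold_gt0 k) a.
  - move=> x /=; rewrite in_itv/= => /andP[a _].
    by rewrite lee_fin invr_ge0 ltW// (lt_trans (threshold_gt0 k)).
have rhov s : `]r, t[%classic s -> \sum_(k < j) v k s <= rho s / s.
  move=> rst; have s0 := itv0 _ rst; have := itvE _ rst; rewrite /= in_itv/= andbT => rs.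
  rewrite /v -mulr_sumr -mulr_sumr mulrCA mulrC ler_wpM2r ?invr_ge0 ?(ltW s0)//.
  elim: j {P0 X0 lnX} => [|j IH]; first by rewrite big_ord0 mulr0 rho_ge0.
  (* Either the last indicator vanishes and induction applies, or [rho s > p (j + 1)] already bounds
     all [j + 1] indicators at once. *)
  have [sj|js] := leP s (threshold j).
    rewrite big_ord_recr /= [X in _ + X]indicE memNset ?addr0//.
    by rewrite /= in_itv/= andbT; apply/negP; rewrite -leNgt.
  apply: le_trans (ltW (rho_gt js)); rewrite ler_pM2l//.
  rewrite -[X in _ <= X%:R]card_ord -sumr_const.
  by apply: ler_sum => i _; rewrite indicE; case: (_ \in _).
apply: (@le_trans _ _ (\sum_(k < j) \int[leb]_(s in `]r, t[) (v k s)%:E)%E).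
  by apply: lee_sum => k _; exact: int_v.
rewrite -ge0_integral_sum//.
- apply: ge0_le_integral => //.
  + by move=> s rst; apply: sume_ge0 => k _; rewrite lee_fin v0.
  + by apply: emeasurable_sum => k; apply/measurable_EFinP; exact: mv.
  + apply/measurable_EFinP; apply: measurable_funM; exact: mitv.
  + by move=> s rst; rewrite sumEFin lee_fin rhov.
- by move=> k; apply/measurable_EFinP; exact: mv.
- by move=> k s rst; rewrite lee_fin v0.
Qed.

End weight.

(** * Moment bounds from the integrability of the weight *)

Lemma integral_mono_ge0 d (T : measurableType d) (R : realType)
    (mu : {measure set T -> \bar R}) (D : set T) (f g : T -> \bar R) :
  (forall x, D x -> (0 <= f x)%E) -> (forall x, D x -> (f x <= g x)%E) ->
  (\int[mu]_(x in D) f x <= \int[mu]_(x in D) g x)%E.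
Proof.
move=> f0 fg; rewrite !ge0_integralE//; last first.
  by move=> x Dx; exact: le_trans (f0 x Dx) (fg x Dx).
apply: le_ereal_sup => _ [h hf <-].
exists h => // x; apply: le_trans (hf x) _.
by rewrite /patch; case: ifPn => // /set_mem; exact: fg.
Qed.

(** Outside the ball of radius [r] the normalised power [f] is bounded by the weight. Inside it [f]
    is at most [1], every threshold being at least [r], and the ball has finite mass as part of a
    compact cube. *)
Lemma exp_weight_moments (R : realType) (n : nat) (r : R) (rho : R -> R) (p : R)
    (mu : {measure set (borelRn R n) -> \bar R}) :
  0 < r -> 1 <= p ->
  (forall s, r < s -> 0 <= rho s) ->
  (forall s t, r < s -> s <= t -> rho s <= rho t) ->
  measurable_fun `]r, +oo[%classic rho ->
  (\int[lebesgue_measure]_(s in `]r, +oo[) (rho s / s ^+ 2)%:E = +oo)%E ->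
  (forall K : set 'rV[R]_n, compact K -> (mu K < +oo)%E) ->
  (\int[mu]_(x in [set x : 'rV[R]_n | (r < enorm x)%R])
     expeR (\int[lebesgue_measure]_(s in `]r, enorm x[) (rho s / s)%:E)
   < +oo)%E ->
  exists2 C, 0 < C & forall j, (cLnorm mu p
    (fun x : borelRn R n => (enorm x ^+ j)%:C%C) <=
      (C * \prod_(k < j) threshold r rho p k)%:E)%E.
Proof.
move=> r0 p1 rho_ge0 rho_mono mrho rho_div mu_compact.
have p0 : 0 < p by exact: lt_le_trans p1.
set A := [set x : 'rV[R]_n | (r < enorm x)%R].
set I := (X in (X < +oo)%E -> _) => Ifin.
have mA : measurable (A : set (borelRn R n)).
  have -> : A = setT `&` @enorm R n @^-1` `]r, +oo[%classic.
    by rewrite setTI; apply/seteqP; split=> x /=; rewrite in_itv/= andbT.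
  by apply: (@measurable_enorm R n) => //; exact: measurable_itv.
pose K := [set x : 'rV[R]_n | forall i, `[- r, r]%classic (x ord0 i)].
have cK : compact K.
  apply: (@rV_compact _ _ (fun=> `[- r, r]%classic)) => i.
  exact: segment_compact.
have mK : measurable (K : set (borelRn R n)).
  rewrite -[K]setCK; apply: measurableC; apply: sub_sigma_algebra.
  by apply: closed_openC; apply: compact_closed => //; exact: norm_hausdorff.
have AK : ~` A `<=` K.
  move=> x /negP; rewrite -leNgt => xr i /=; rewrite in_itv/= -ler_norml.
  exact: le_trans (coord_le_enorm x i) xr.
have muA : (mu (~` A) < +oo)%E.
  apply: le_lt_trans (mu_compact K cK).
  by apply: le_measure; rewrite ?inE//; exact: measurableC.
have I0 : (0 <= I)%E by apply: integral_ge0 => x _; exact: expeR_ge0.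
have fI : I \is a fin_num by rewrite ge0_fin_numE.
have fA : mu (~` A) \is a fin_num by rewrite ge0_fin_numE.
pose B := fine I + fine (mu (~` A)).
have B0 : 0 <= B by rewrite addr_ge0// fine_ge0.
(* The estimate ends with [B <= (B + 1) ^ p], which holds because [B + 1 >= 1]; [B] alone could be
   less than [1]. *)
exists (B + 1) => [|j]; first by rewrite ltr_wpDl.
pose P := \prod_(k < j) threshold r rho p k.
have thr_ge k : r <= threshold r rho p k by exact: (threshold_ge r0 p0 rho_ge0 rho_mono mrho rho_div).
have P0 : 0 < P by apply: prodr_gt0 => k _; exact: lt_le_trans (thr_ge k).
have rP : r ^+ j <= P.
  rewrite /P; elim: j {P P0} => [|j IH]; first by rewrite big_ord0 expr0.
  by rewrite big_ord_recr/= exprSr ler_pM ?exprn_ge0// ltW.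
pose f (x : borelRn R n) : R := (enorm x ^+ j / P) `^ p.
have mf : measurable_fun setT f.
  apply: (@measurableT_comp _ _ _ _ _ _ (@powR R ^~ p)) => //.
  apply: measurable_funM; last exact: measurable_cst.
  by apply: measurable_funX; exact: measurable_enorm.
have f0 x : 0 <= f x by exact: powR_ge0.
have intf : (\int[mu]_x (f x)%:E <= B%:E)%E.
  rewrite -(setUv A) ge0_integral_setU ?setUv//; last 4 first.
  - exact: measurableC.
  - exact/measurable_EFinP.
  - by move=> x _; rewrite lee_fin.
  - exact/disj_set2P/setICr.
  rewrite /B EFinD !fineK//; apply: leeD.
    apply: integral_mono_ge0 => x Ax; first by rewrite lee_fin.
    exact: (threshold_growth r0 p0 rho_ge0 rho_mono mrho rho_div).
  rewrite -[leRHS]mul1e -integral_cst//; last exact: measurableC.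
  apply: integral_mono_ge0 => x xA; first by rewrite lee_fin.
  have xr : enorm x <= r by rewrite leNgt; exact/negP.
  have u1 : enorm x ^+ j / P <= 1.
    rewrite ler_pdivrMr// mul1r; apply: le_trans rP.
    by rewrite lerXn2r ?nnegrE ?enorm_ge0// ltW.
  rewrite lee_fin /f; have <- : 1 `^ p = 1 :> R by rewrite powR1.
  apply: ge0_ler_powR; rewrite ?nnegrE ?(ltW p0)//.
  by rewrite divr_ge0 ?exprn_ge0 ?enorm_ge0// ltW.
apply: cLnorm_le => //; first by rewrite mulr_ge0 ?(ltW P0)// addr_ge0.
have -> : Lp_integral mu p (fun x : borelRn R n => (enorm x ^+ j)%:C%C) =
    ((P `^ p)%:E * \int[mu]_x (f x)%:E)%E.
  rewrite -ge0_integralZl ?lee_fin ?powR_ge0//; last 2 first.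
  - exact/measurable_EFinP.
  - by move=> x _; rewrite lee_fin.
  apply: eq_integral => x _; have sj : 0 <= enorm x ^+ j by rewrite exprn_ge0// enorm_ge0.
  rewrite normcR ger0_norm// -EFinM -powRM ?divr_ge0 ?(ltW P0)//.
  by rewrite mulrCA mulfV ?mulr1// gt_eqF.
apply: (@le_trans _ _ ((P `^ p)%:E * B%:E)%E).
  by rewrite lee_wpmul2l// lee_fin powR_ge0.
have B1 : 0 <= B + 1 by exact: addr_ge0.
rewrite -/P -EFinM lee_fin (powRM _ B1 (ltW P0)) mulrC ler_wpM2r ?powR_ge0//.
apply: (@le_trans _ _ (B + 1)); first by rewrite lerDl.
by apply: le1r_powR => //; rewrite lerDr.
Qed.

Unset Implicit Arguments.
Set Strict Implicit.

Theorem theorem1p1 (R : realType) (n : nat) (r : R) (rho : R -> R)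
    (mu : {measure set (borelRn R n) -> \bar R}) :
  0 < r ->
  (forall s, r < s -> 0 <= rho s) ->
  (forall s t, r < s -> s <= t -> rho s <= rho t) ->
  C1_on `]r, +oo[ rho ->
  (\int[lebesgue_measure]_(s in `]r, +oo[) (rho s / s ^+ 2)%:E = +oo)%E ->
  (* mu is a Borel measure in the usual sense: finite on compact sets *)
  (forall K : set 'rV[R]_n, compact K -> (mu K < +oo)%E) ->
  (\int[mu]_(x in [set x : 'rV[R]_n | (r < enorm x)%R])
     expeR (\int[lebesgue_measure]_(s in `]r, enorm x[) (rho s / s)%:E)
   < +oo)%E ->
  determinate mu /\
  forall p : R, 1 <= p ->
    dense_in_Lp mu p (range polyfun) /\
    forall S : set 'rV[R]_n, somewhere_dense S ->
      dense_in_Lp mu p (Cspan (expi @` S)).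
Proof.
move=> r0 rho_ge0 rho_mono rhoC1 rho_div mu_compact mu_int.
have mrho : measurable_fun `]r, +oo[%classic rho.
  apply: open_continuous_measurable_fun; first exact: rray_open.
  move=> s /set_mem /rhoC1[ds _].
  exact/differentiable_continuous/derivable1_diffP.
have moments p p1 := @exp_weight_moments R n r rho p mu r0 p1 rho_ge0 rho_mono
  mrho rho_div mu_compact mu_int.
have gt0 (p : R) : 1 <= p -> 0 < p by exact: lt_le_trans.
have thr_gt0 p (p1 : 1 <= p) k :=
  threshold_gt0 r0 (gt0 p p1) rho_ge0 rho_mono mrho rho_div k.
have thr_mono p (p1 : 1 <= p) k l kl :=
  @threshold_mono R r rho p r0 (gt0 p p1) rho_ge0 rho_mono mrho rho_div k l kl.
have thr_div p (p1 : 1 <= p) :=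
  threshold_div r0 (gt0 p p1) rho_ge0 rho_mono mrho rho_div.
split=> [|p p1].
  have p2 : 1 <= 2 :> R by rewrite ler1n.
  (* Determinacy uses the thresholds for exponent [2], which control the even moments. *)
  have [C C0 HC] := moments 2 p2.
  exact: (growth_determinate C0 (thr_gt0 2 p2) (thr_mono 2 p2) (thr_div 2 p2) HC).
have [C C0 HC] := moments p p1; split=> [|S].
  exact: (polyfun_dense p1 C0 (thr_gt0 p p1) (thr_mono p p1) (thr_div p p1) HC).
exact: (expi_dense p1 C0 (thr_gt0 p p1) (thr_mono p p1) (thr_div p p1) HC).
Qed.
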